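(* Let $M$ be a foliate contact $CR$-submanifold of a Sasakian statistical manifold $(\bar M,\bar\nabla,\bar g,\phi,\xi)$, with distributions $D$ and $D^\perp$, which is mixed totally geodesic with respect to $\bar\nabla$ (respectively $\bar\nabla^*$). Then \[ A^*_V\phi X+\phi A^*_VX=0\qquad(\text{respectively } A_V\phi X+\phi A_VX=0) \] for all $X\in\Gamma(D)$ and all normal vector fields $V$.
   Context: A statistical manifold $(\bar M,\bar\nabla,\bar g)$ is a smooth Riemannian manifold $(\bar M,\bar g)$ with a torsion-free affine connection $\bar\nabla$ such that $(\bar\nabla_X\bar g)(Y,Z)=(\bar\nabla_Y\bar g)(X,Z)$. The dual connection $\bar\nabla^*$ is defined by $X\bar g(Y,Z)=\bar g(\bar\nabla_XY,Z)+\bar g(Y,\bar\nabla^*_XZ)$. Let $\hat{\bar\nabla}$ be the Levi-Civita connection of $\bar g$ and $K(X,Y)=\bar\nabla_XY-\hat{\bar\nabla}_XY$. An almost contact metric structure on an odd-dimensional $(\bar M,\bar g)$ consists of a $(1,1)$-tensor $\phi$, a unit vector field $\xi$ and a 1-form $\eta$ with $\phi^2X=-X+\eta(X)\xi$, $\bar g(X,\xi)=\eta(X)$, $\bar g(\phi X,\phi Y)=\bar g(X,Y)-\eta(X)\eta(Y)$ (so $\phi\xi=0$, $\eta\circ\phi=0$, $\bar g(\phi X,Y)=-\bar g(X,\phi Y)$). A Sasakian statistical manifold $(\bar M,\bar\nabla,\bar g,\phi,\xi)$ is a statistical manifold with an almost contact metric structure such that $\hat{\bar\nabla}_X\xi=\phi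 X$, $(\hat{\bar\nabla}_X\phi)Y=\bar g(Y,\xi)X-\bar g(Y,X)\xi$ and $K(X,\phi Y)+\phi K(X,Y)=0$. Consequently $\bar\nabla_X\phi Y-\phi\bar\nabla^*_XY=\bar g(Y,\xi)X-\bar g(Y,X)\xi$ and $\bar\nabla_X\xi=\phi X+\bar g(\bar\nabla_X\xi,\xi)\xi$, and the same identities hold with $\bar\nabla$ and $\bar\nabla^*$ interchanged. For a submanifold $M$ with induced metric $g$ ($g$ also denotes $\bar g$ on normal vectors), $X,Y\in\Gamma(TM)$ and $V\in\Gamma(T^\perp M)$, split into tangential and normal parts: $\bar\nabla_XY=\nabla_XY+h(X,Y)$, $\bar\nabla^*_XY=\nabla^*_XY+h^*(X,Y)$, $\bar\nabla_XV=-A_VX+\nabla^\perp_XV$, $\bar\nabla^*_XV=-A^*_VX+\nabla^{*\perp}_XV$. One has $g(A_VX,Y)=g(h^*(X,Y),V)$ and $g(A^*_VX,Y)=g(h(X,Y),V)$. $M$ is a contact $CR$-submanifold if $TM=D\oplus D^\perp$ for a differentiable distribution $D$ with $\xi\in\Gamma(D)$, $\phi(D_x)\subseteq D_x$, and with orthogonal complement $D^\perp$ satisfying $\phi(D^\perp_x)\subseteq T^\perp_xM$ for all $x\in M$. It is foliate if $D$ is involutive. It is mixed totally geodesic with respect to $\bar\nabla$ (respectively $\bar\nabla^*$) if $h(X,Y)=0$ (respectively $h^*(X,Y)=0$) for all $X\in\Gamma(D)$ and $Y\in\Gamma(D^\perp)$. *)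

(* Defs.v *)
From HB Require Import structures.
From mathcomp Require Import all_boot all_order all_algebra.
From mathcomp Require Import all_classical all_reals all_analysis.

Set Implicit Arguments.
Unset Strict Implicit.
Unset Printing Implicit Defensive.

Import Order.TTheory GRing.Theory Num.Theory.
Import numFieldNormedType.Exports.

Local Open Scope classical_set_scope.
Local Open Scope ring_scope.

(** * Smooth manifolds *)

Section Calculus.
Variables (R : realType) (V W : normedModType R).

(* [V] is always finite-dimensional below, so that asking all the directional
   derivatives [x |-> 'd f x v] to be C^k is the usual C^(k+1) condition. *)
Fixpoint Ck (k : nat) (U : set V) (f : V -> W) : Prop :=
  match k with
  | 0%N => forall x, U x -> {for x, continuous f}
  | k'.+1 => (forall x, U x -> differentiable f x) /\
             (forall v, Ck k' U (fun x => 'd f x v))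
  end.

Definition smooth_on (U : set V) (f : V -> W) : Prop := forall k, Ck k U f.

End Calculus.

Record chart (R : realType) (n : nat) (T : Type) := Chart {
  cdom : set T;
  cmap : T -> 'rV[R]_n;
  cinv : 'rV[R]_n -> T }.

(* A chart is a homeomorphism of the open set [cdom c] onto the open set
   [cimg c]; [cmap c] and [cinv c] are irrelevant outside these sets. *)
Definition cimg (R : realType) (n : nat) (T : Type) (c : chart R n T) :
  set 'rV[R]_n := cmap c @` cdom c.

Definition is_chart (R : realType) (n : nat) (T : topologicalType)
    (c : chart R n T) : Prop :=
  [/\ open (cdom c), open (cimg c),
      forall x, cdom c x -> cinv c (cmap c x) = x,
      forall x, cdom c x -> {for x, continuous (cmap c)} &
      forall y, cimg c y -> {for y, continuous (cinv c)}].

Record manifold (R : realType) (n : nat) := Manifold {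
  msort :> topologicalType;
  atlas : set (chart R n msort);
  atlas_chart : forall c, atlas c -> is_chart c;
  atlas_cover : forall x, exists2 c, atlas c & cdom c x;
  atlas_compat : forall c d, atlas c -> atlas d ->
    smooth_on (cmap c @` (cdom c `&` cdom d)) (cmap d \o cinv c);
  manifold_hausdorff : hausdorff_space msort;
  manifold_second_countable : @second_countable msort }.

Definition smooth (R : realType) (n : nat) (M : manifold R n) (f : M -> R) :
  Prop := forall c, atlas c -> smooth_on (cimg c) (f \o cinv c).

Definition smooth_map (R : realType) (m n : nat) (M : manifold R m)
    (N : manifold R n) (F : M -> N) : Prop :=
  continuous F /\
  forall c d, atlas c -> atlas d ->
    smooth_on (cmap c @` (cdom c `&` F @^-1` cdom d)) (cmap d \o F \o cinv c).

(** * Tangent vectors and vector fields *)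

(* Tangent vectors act on functions. So that they are determined by their
   values on smooth functions, they send every other function to 0. *)
Notation tvec R M := ((msort M -> R) -> R).

(* [tangent p v] says that [v] is the derivative at [p] in the direction [a],
   read in a chart around [p], i.e. [v = \sum_i a_i (d/dx^i)_p]. *)
Definition tangent (R : realType) (n : nat) (M : manifold R n) (p : M)
    (v : tvec R M) : Prop :=
  exists c a, [/\ atlas c, cdom c p &
    v = fun f => if `[< smooth f >] then 'd (f \o cinv c) (cmap c p) a else 0].

(* Sections of the pull-back of the tangent bundle of [N] by [F]. *)
Definition vfield_along (R : realType) (m n : nat) (M : manifold R m)
    (N : manifold R n) (F : M -> N) (V : M -> tvec R N) : Prop :=
  (forall x, tangent (F x) (V x)) /\
  (forall f : N -> R, smooth f -> smooth (fun x => V x f)).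

Definition vfield (R : realType) (n : nat) (M : manifold R n)
    (X : M -> tvec R M) : Prop := vfield_along (id : M -> M) X.

Definition fscale (R : realType) (m n : nat) (M : manifold R m)
    (N : manifold R n) (f : M -> R) (V : M -> tvec R N) : M -> tvec R N :=
  fun x => f x *: V x.

Definition bracket (R : realType) (n : nat) (M : manifold R n)
    (X Y : M -> tvec R M) : M -> tvec R M :=
  fun p f => X p (fun q => Y q f) - Y p (fun q => X q f).

Definition tmap (R : realType) (m n : nat) (M : manifold R m)
    (N : manifold R n) (F : M -> N) (v : tvec R M) : tvec R N :=
  fun f => if `[< smooth f >] then v (f \o F) else 0.

Definition immersion (R : realType) (m n : nat) (M : manifold R m)
    (N : manifold R n) (F : M -> N) : Prop :=
  smooth_map F /\
  forall x v w, tangent x v -> tangent x w -> tmap F v = tmap F w -> v = w.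

(** * Tensors and connections *)

Section Structures.
Variables (R : realType) (n : nat) (M : manifold R n).
Implicit Types (X Y Z : M -> tvec R M) (f : M -> R).
Implicit Types (g : M -> tvec R M -> tvec R M -> R).
Implicit Types (nabla : (M -> tvec R M) -> (M -> tvec R M) -> (M -> tvec R M)).

Definition riemannian_metric g : Prop :=
  [/\ forall p a u v w, tangent p u -> tangent p v -> tangent p w ->
        g p (a *: u + v) w = a * g p u w + g p v w,
      forall p u v, tangent p u -> tangent p v -> g p u v = g p v u,
      forall p u, tangent p u -> u != 0 -> 0 < g p u u &
      forall X Y, vfield X -> vfield Y -> smooth (fun p => g p (X p) (Y p))].

Definition tensor11 (phi : M -> tvec R M -> tvec R M) : Prop :=
  [/\ forall p u, tangent p u -> tangent p (phi p u),
      forall p a u v, tangent p u -> tangent p v ->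
        phi p (a *: u + v) = a *: phi p u + phi p v &
      forall X, vfield X -> vfield (fun p => phi p (X p))].

Definition one_form (eta : M -> tvec R M -> R) : Prop :=
  (forall p a u v, tangent p u -> tangent p v ->
     eta p (a *: u + v) = a * eta p u + eta p v) /\
  (forall X, vfield X -> smooth (fun p => eta p (X p))).

Definition affine_connection nabla : Prop :=
  [/\ forall X Y, vfield X -> vfield Y -> vfield (nabla X Y),
      forall f X X' Y, smooth f -> vfield X -> vfield X' -> vfield Y ->
        nabla (fscale f X + X') Y = fscale f (nabla X Y) + nabla X' Y,
      forall X Y Y', vfield X -> vfield Y -> vfield Y' ->
        nabla X (Y + Y') = nabla X Y + nabla X Y' &
      forall f X Y, smooth f -> vfield X -> vfield Y ->
        nabla X (fscale f Y) = fscale (fun p => X p f) Y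
                               + fscale f (nabla X Y)].

Definition torsion_free nabla : Prop :=
  forall X Y, vfield X -> vfield Y ->
    nabla X Y - nabla Y X = bracket X Y.

(* [(nabla_X g)(Y, Z)] *)
Definition nabla_metric nabla g X Y Z : M -> R :=
  fun p => X p (fun q => g q (Y q) (Z q))
           - g p (nabla X Y p) (Z p) - g p (Y p) (nabla X Z p).

Definition levi_civita g nabla : Prop :=
  [/\ affine_connection nabla, torsion_free nabla &
      forall X Y Z, vfield X -> vfield Y -> vfield Z ->
        nabla_metric nabla g X Y Z = fun=> 0].

Definition statistical_manifold nabla g : Prop :=
  [/\ riemannian_metric g, affine_connection nabla, torsion_free nabla &
      forall X Y Z, vfield X -> vfield Y -> vfield Z ->
        nabla_metric nabla g X Y Z = nabla_metric nabla g Y X Z].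

Definition dual_connection g nabla nablas : Prop :=
  affine_connection nablas /\
  forall X Y Z, vfield X -> vfield Y -> vfield Z -> forall p,
    X p (fun q => g q (Y q) (Z q)) =
    g p (nabla X Y p) (Z p) + g p (Y p) (nablas X Z p).

Definition almost_contact_metric g (phi : M -> tvec R M -> tvec R M)
    (xi : M -> tvec R M) (eta : M -> tvec R M -> R) : Prop :=
  [/\ [/\ tensor11 phi, vfield xi & one_form eta],
      forall p, g p (xi p) (xi p) = 1,
      forall p u, tangent p u -> phi p (phi p u) = - u + eta p u *: xi p,
      forall p u, tangent p u -> g p u (xi p) = eta p u &
      forall p u v, tangent p u -> tangent p v ->
        g p (phi p u) (phi p v) = g p u v - eta p u * eta p v].

Definition sasakian_statistical nabla g (phi : M -> tvec R M -> tvec R M)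
    (xi : M -> tvec R M) (eta : M -> tvec R M -> R) : Prop :=
  [/\ statistical_manifold nabla g, almost_contact_metric g phi xi eta &
   exists nablah, [/\ levi_civita g nablah,
     forall X, vfield X -> nablah X xi = fun p => phi p (X p),
     forall X Y, vfield X -> vfield Y -> forall p,
       nablah X (fun q => phi q (Y q)) p - phi p (nablah X Y p) =
       g p (Y p) (xi p) *: X p - g p (Y p) (X p) *: xi p &
     let K X Y := nabla X Y - nablah X Y in
     forall X Y, vfield X -> vfield Y -> forall p,
       K X (fun q => phi q (Y q)) p + phi p (K X Y p) = 0]].

(* Local frames by global fields lose no generality, thanks to cut-off
   functions. *)
Definition smooth_distribution (D : M -> set (tvec R M)) : Prop :=
  forall x : M, exists k (E : 'I_k -> M -> tvec R M),
    (forall i, vfield (E i)) /\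
    \forall y \near x, forall v,
      D y v <-> exists! a : 'rV[R]_k, v = \sum_i a 0 i *: E i y.

Definition section (D : M -> set (tvec R M)) X : Prop :=
  vfield X /\ forall x, D x (X x).

Definition involutive_distribution (D : M -> set (tvec R M)) : Prop :=
  forall X Y, section D X -> section D Y -> section D (bracket X Y).

Definition orthocompl g (D : M -> set (tvec R M)) (x : M) : set (tvec R M) :=
  [set v | tangent x v /\ forall w, D x w -> g x v w = 0].

End Structures.

(** * Submanifolds *)

Section Submanifold.
Variables (R : realType) (m n : nat) (N : manifold R m) (M : manifold R n).
Variables (iota : M -> N) (g : N -> tvec R N -> tvec R N -> R).

Definition push (X : M -> tvec R M) : M -> tvec R N :=
  fun x => tmap iota (X x).

Definition induced_metric : M -> tvec R M -> tvec R M -> R :=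
  fun x u v => g (iota x) (tmap iota u) (tmap iota v).

(* The covariant derivative, in directions tangent to [M], of fields of
   [N]-vectors along [iota]: the unique operator satisfying these conditions.
   The last one says that it is computed by extending the arguments to [N]. *)
Definition induced_connection
    (nabla : (N -> tvec R N) -> (N -> tvec R N) -> (N -> tvec R N))
    (nb : (M -> tvec R M) -> (M -> tvec R N) -> (M -> tvec R N)) : Prop :=
  [/\ forall X V, vfield X -> vfield_along iota V ->
        vfield_along iota (nb X V),
      forall f X X' V, smooth f -> vfield X -> vfield X' ->
        vfield_along iota V ->
        nb (fscale f X + X') V = fscale f (nb X V) + nb X' V,
      forall X V V', vfield X -> vfield_along iota V ->
        vfield_along iota V' -> nb X (V + V') = nb X V + nb X V',
      forall f X V, smooth f -> vfield X -> vfield_along iota V ->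
        nb X (fscale f V) = fscale (fun x => X x f) V + fscale f (nb X V) &
      forall X X' Y x, vfield X -> vfield X' -> vfield Y ->
        X' (iota x) = push X x -> nb X (Y \o iota) x = nabla X' Y (iota x)].

Definition normal (x : M) (u : tvec R N) : Prop :=
  tangent (iota x) u /\
  forall v, tangent x v -> g (iota x) u (tmap iota v) = 0.

Definition normal_field (V : M -> tvec R N) : Prop :=
  vfield_along iota V /\ forall x, normal x (V x).

Definition tan_part (x : M) (u : tvec R N) : tvec R M :=
  xget 0 [set v | tangent x v /\ normal x (u - tmap iota v)].

Definition nor_part (x : M) (u : tvec R N) : tvec R N :=
  u - tmap iota (tan_part x u).

(* [h(X, Y)] *)
Definition second_form
    (nb : (M -> tvec R M) -> (M -> tvec R N) -> (M -> tvec R N))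
    (X Y : M -> tvec R M) : M -> tvec R N :=
  fun x => nor_part x (nb X (push Y) x).

(* [A_V X] *)
Definition shape_op
    (nb : (M -> tvec R M) -> (M -> tvec R N) -> (M -> tvec R N))
    (V : M -> tvec R N) (X : M -> tvec R M) : M -> tvec R M :=
  fun x => - tan_part x (nb X V x).

(* The field [phi X] on [M], for [X] such that [phi X] is tangent to [M]. *)
Definition phi_tan (phi : N -> tvec R N -> tvec R N) (X : M -> tvec R M) :
    M -> tvec R M :=
  fun x => tan_part x (phi (iota x) (push X x)).

Definition contact_CR (phi : N -> tvec R N -> tvec R N) (xi : N -> tvec R N)
    (D : M -> set (tvec R M)) : Prop :=
  let Dperp := orthocompl induced_metric D in
  [/\ smooth_distribution D,
      forall x v, tangent x v ->
        exists d e, [/\ D x d, Dperp x e & v = d + e],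
      exists2 xiM, section D xiM & push xiM = xi \o iota,
      forall x v, D x v ->
        exists2 w, D x w & tmap iota w = phi (iota x) (tmap iota v) &
      forall x v, Dperp x v -> normal x (phi (iota x) (tmap iota v))].

Definition mixed_totally_geodesic (D : M -> set (tvec R M))
    (nb : (M -> tvec R M) -> (M -> tvec R N) -> (M -> tvec R N)) : Prop :=
  forall X Y, section D X -> section (orthocompl induced_metric D) Y ->
    second_form nb X Y = fun=> 0.

End Submanifold.

(* Main.v *)
From HB Require Import structures.
Require Import Defs.
From mathcomp Require Import all_boot all_order all_algebra.
From mathcomp Require Import all_classical all_reals all_analysis.
From mathcomp Require Import ring lra.

Set Implicit Arguments.
Unset Strict Implicit.
Unset Printing Implicit Defensive.

Import Order.TTheory GRing.Theory Num.Theory.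
Import numFieldNormedType.Exports.

Local Open Scope classical_set_scope.
Local Open Scope ring_scope.

(** Write [A] for the shape operator of the connection dual to the one for which
    [M] is mixed totally geodesic, and [h] for the second fundamental form of
    the latter; they are related by [g (A_V X) Y = g (h (X, Y)) V]
    ([shape_op_metric]).

    For [X] in [D], mixed geodesy says that [A_V X] is orthogonal to the
    complement of [D], so [A_V X] lies in [D] ([shape_op_D]), and the same holds
    for [A_V (phi X)].  Hence [A_V (phi X) + phi (A_V X)] is tangent to [M] and
    lies in [D], and it suffices to pair it with [Y] in [D].  Since [phi] is
    skew, the pairing is [g (h (phi X, Y) - h (X, phi Y)) V].  The normal part
    of the Sasakian structure identity gives
    [g (h (X, phi Y)) V = g (phi (nablas_X Y)) V] ([normal_phi]), and likewise
    with [X] and [Y] exchanged, so that, [h] being symmetric and [nablas]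
    torsion-free, the pairing becomes [g (phi [Y, X]) V].  This vanishes because
    [D] is involutive and stable under [phi].

    The structure identity for the dual pair holds because the dual connection
    is the reflection of [nabla] in the Levi-Civita connection
    ([dual_reflection]); the difference tensor is totally symmetric by Codazzi's
    equation and anticommutes with [phi], and so it drops out ([sasakian_phi]).

    These arguments use three identities for the induced connections: duality,
    symmetry of [h] and the structure identity ([induced_duality],
    [induced_torsion_free], [induced_phi]).  An induced connection is
    characterized only on restrictions of ambient fields, so each identity is
    first seen to be tensorial in its arguments; a tensorial functional that
    vanishes on restrictions of ambient fields vanishes ([tensorial_restriction]).
    That principle rests on frames of global fields, cut off by a smooth bump
    function [f] ([bump_frame], [along_expand]).  No plateau of [f] is needed:
    if [psi_i = f y^i] with [y^i] the coordinates, then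
    [f * V psi_i - psi_i * V f = f^2 * V^i], so that [f^3 V] is globally a
    combination, with smooth coefficients, of the fields [f d/dy^i].

    Values of the distribution and of its complement are extended to sections by
    Gram matrices ([section_extend], [orthocompl_extend]); the same device shows
    that [phi X] is a smooth section of [D] ([phi_tan_section]). *)

(** * Smooth functions on normed spaces *)

Section Differentiability.
Variables (R : realType) (V W : normedModType R).
Implicit Types (f g : V -> W) (x v : V).

(** The increments of [f] vanish near [x], so they are in particular [o(h)]. *)
Lemma near_zero_diff f x : (\forall y \near x, f y = 0) ->
  differentiable f x /\ 'd f x = 0 :> (V -> W).
Proof.
move=> f0.
have E : f \o shift x = cst (f x) + (0 : V -> W) +o_ (0 : V) id.
  apply/eqaddoP => e e0; near=> h.
  have f0h : f (h + x) = 0.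
    near: h; move: f0; rewrite (near_shift 0 x) subr0.
    by apply: filterS => h.
  rewrite addr0 !fctE /= f0h (nbhs_singleton f0) subrr normr0.
  by rewrite mulr_ge0 // ltW.
have D0 : 'd f x = 0 :> (V -> W).
  by apply: diff_unique => //; apply: cst_continuous.
split=> //; apply/diff_locallyP; rewrite D0; split=> //.
exact: cst_continuous.
Unshelve. all: by end_near. Qed.

(** Add to [f] the difference [g - f], which vanishes near [x]. *)
Lemma near_eq_diff f g x : (\forall y \near x, f y = g y) ->
  differentiable f x -> differentiable g x /\ 'd g x = 'd f x :> (V -> W).
Proof.
move=> fg df.
have [dh h0] : differentiable (g - f) x /\ 'd (g - f) x = 0 :> (V -> W).
  by apply: near_zero_diff; apply: filterS fg => y fgy; rewrite !fctE fgy subrr.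
have -> : g = f + (g - f) by rewrite addrC subrK.
split; first exact: differentiableD.
apply/funext => v.
have add0 (a b c : W) : a = b + c -> c = 0 -> a = b.
  by move=> -> ->; rewrite addr0.
exact: add0 (congr1 (fun l => l v) (diffD df dh)) (congr1 (fun l => l v) h0).
Qed.

Lemma Ck_sub k (U U' : set V) f : U' `<=` U -> Ck k U f -> Ck k U' f.
Proof.
elim: k f => [|k IH] f UU' /=; first by move=> cf x /UU'; exact: cf.
by case=> df ddf; split=> [x /UU' /df //|v]; apply: IH.
Qed.

Lemma Ck_local k (U : set V) f :
  (forall x, U x -> exists2 U', U' x & Ck k U' f) -> Ck k U f.
Proof.
elim: k f => [|k IH] f /= H; first by move=> x /H[U' U'x]; apply.
split=> [x /H[U' U'x [df _]]|v]; first exact: df.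
by apply: IH => x /H[U' U'x [_ ddf]]; exists U'.
Qed.

(** A differential at a point depends on the values nearby, whence the openness
    of [U]. *)
Lemma Ck_ext k (U : set V) f g : open U -> (forall x, U x -> f x = g x) ->
  Ck k U f -> Ck k U g.
Proof.
move=> oU; elim: k f g => [|k IH] f g fg /=.
  move=> cf x Ux; rewrite /prop_for /continuous_at -fg //.
  apply: cvg_trans (cf x Ux); apply: near_eq_cvg.
  by apply: filterS (open_nbhs_nbhs (conj oU Ux)) => y /fg.
have near_fg x : U x -> \forall y \near x, f y = g y.
  by move=> Ux; apply: filterS (open_nbhs_nbhs (conj oU Ux)) => y /fg.
case=> df ddf; split=> [x Ux|v].
  by have [] := near_eq_diff (near_fg x Ux) (df x Ux).
apply: IH (ddf v) => x Ux.
by have [_ ->] := near_eq_diff (near_fg x Ux) (df x Ux).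
Qed.

Lemma Ck_continuous k (U : set V) f : Ck k U f ->
  forall x, U x -> {for x, continuous f}.
Proof.
case: k => [//|k [df _] x Ux].
exact: differentiable_continuous (df x Ux).
Qed.

Lemma Ck_pred k (U : set V) f : Ck k.+1 U f -> Ck k U f.
Proof.
elim: k f => [|k IH] f; first exact: (@Ck_continuous 1).
by case=> df ddf; split=> // v; apply: IH.
Qed.

Lemma Ck_cst k (U : set V) (a : W) : Ck k U (cst a).
Proof.
elim: k a => [|k IH] a /=; first by move=> x _; apply: cst_continuous.
split=> [x _|v]; first exact: differentiable_cst.
rewrite (_ : (fun x => _) = cst 0); first exact: IH.
by apply/funext => x; rewrite diff_cst.
Qed.

Lemma Ck_add k (U : set V) f g : open U -> Ck k U f -> Ck k U g ->
  Ck k U (fun x => f x + g x).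
Proof.
move=> oU; elim: k f g => [|k IH] f g /=.
  by move=> cf cg x Ux; apply: continuousD; [exact: cf|exact: cg].
move=> [df ddf] [dg ddg]; split=> [x Ux|v].
  by apply: differentiableD; [exact: df|exact: dg].
apply: Ck_ext oU _ (IH _ _ (ddf v) (ddg v)) => x Ux.
exact/esym/(congr1 (fun l => l v) (diffD (df x Ux) (dg x Ux))).
Qed.

End Differentiability.

Section ScalarCk.
Variables (R : realType) (V : normedModType R).
Implicit Types (f g : V -> R) (U : set V).

Lemma Ck_mul k U f g : open U -> Ck k U f -> Ck k U g ->
  Ck k U (fun x => f x * g x).
Proof.
move=> oU; elim: k f g => [|k IH] f g.
  by move=> cf cg x Ux; apply: continuousM; [exact: cf|exact: cg].
move=> cf cg; have [df ddf] := cf; have [dg ddg] := cg; split=> [x Ux|v].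
  by apply: differentiableM; [exact: df|exact: dg].
have cf' := Ck_pred cf; have cg' := Ck_pred cg.
have H := Ck_add oU (IH _ _ cf' (ddg v)) (IH _ _ cg' (ddf v)).
apply: (Ck_ext oU _ H).
by move=> x Ux; apply/esym/(congr1 (fun l => l v) (diffM (df x Ux) (dg x Ux))).
Qed.

(** The derivative of [1/f] is [- (1/f) (1/f) f'], so the induction stays
    inside products of functions already treated. *)
Lemma Ck_inv k U f : open U -> (forall x, U x -> f x != 0) -> Ck k U f ->
  Ck k U (fun x => (f x)^-1).
Proof.
move=> oU f0; elim: k => [|k IH].
  by move=> cf x Ux; apply: continuousV; [exact: f0|exact: cf].
move=> cf; have [df ddf] := cf; split=> [x Ux|v].
  by apply: differentiableV; [exact: df|exact: f0].
have c := IH (Ck_pred cf).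
have cN1 : Ck k U (cst (-1 : R)) by exact: Ck_cst.
apply: Ck_ext oU _ (Ck_mul oU (Ck_mul oU cN1 (Ck_mul oU c c)) (ddf v)).
move=> x Ux; apply: esym.
apply: etrans (congr1 (fun l => l v) (diffV (df x Ux) (f0 x Ux))) _.
rewrite [LHS]/= /GRing.scale /=.
by rewrite -invfM -expr2 mulN1r.
Qed.

Lemma Ck_sum k U (I : Type) (r : seq I) (F : I -> V -> R) : open U ->
  (forall i, Ck k U (F i)) -> Ck k U (fun x => \sum_(i <- r) F i x).
Proof.
move=> oU CF; elim: r => [|i r IH].
  by under eq_fun do rewrite big_nil; exact: Ck_cst.
by under eq_fun do rewrite big_cons; apply: Ck_add.
Qed.

End ScalarCk.

Lemma diff_idE (R : realType) (V : normedModType R) (x v : V) : 'd (@id V) x v = v.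
Proof.
have E : 'd (@id V) x = id :> (V -> V) by apply: diff_val.
exact: (congr1 (fun l => l v) E).
Qed.

Lemma Ck_id (R : realType) (V : normedModType R) k (U : set V) : open U ->
  Ck k U (@id V).
Proof.
move=> oU; case: k => [|k]; first by move=> x _; exact: cvg_id.
split=> [x _|v]; first by apply: ex_diff.
apply: (@Ck_ext _ _ _ k _ (cst v)) => //; last exact: Ck_cst.
by move=> x _; rewrite diff_idE.
Qed.

Section Composition.
Variables (R : realType) (n m : nat).
Implicit Types (U : set 'rV[R]_n) (h : 'rV[R]_n -> 'rV[R]_m).

Lemma diff_coord (V : normedModType R) (f : V -> 'rV[R]_m) x j v : differentiable f x ->
  differentiable (fun y => f y 0 j) x /\
  'd (fun y => f y 0 j) x v = ('d f x v) 0 j.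
Proof.
move=> df; have dc := @differentiable_coord R 1 m (f x) 0 j.
split; first exact: (differentiable_comp df dc).
rewrite (_ : (fun y => f y 0 j) = (fun N : 'rV[R]_m => N 0 j) \o f) //.
rewrite (diff_comp df dc) /=.
pose cj := (fun N : 'rV[R]_m => N 0 j).
have lc : linear cj by move=> a u w; rewrite /cj !mxE.
pose L : {linear 'rV[R]_m -> R} := HB.pack cj (GRing.isLinear.Build _ _ _ _ _ lc).
have : 'd L (f x) = L :> (_ -> _).
  by apply: diff_lin; exact: coord_continuous.
by move=> /(congr1 (fun k => k ('d f x v))).
Qed.

Lemma Ck_coord (V : normedModType R) k (U : set V) (h : V -> 'rV[R]_m) j :
  open U -> Ck k U h -> Ck k U (fun x => h x 0 j).
Proof.
move=> oU; elim: k h => [|k IH] h.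
  move=> ch x Ux; apply: (@continuous_comp _ _ _ h (fun N : 'rV[R]_m => N 0 j)).
    exact: ch.
  exact: coord_continuous.
move=> [dh ddh]; split=> [x Ux|v]; first by have [] := @diff_coord _ h x j 0 (dh x Ux).
apply: Ck_ext oU _ (IH _ (ddh v)) => x Ux.
by have [_ ->] := @diff_coord _ h x j v (dh x Ux).
Qed.

Lemma diff_row_sum (f : 'rV[R]_m -> R) y (a : 'rV[R]_m) :
  'd f y a = \sum_j a 0 j * 'd f y (delta_mx 0 j).
Proof.
rewrite {1}[a]row_sum_delta raddf_sum /=.
by apply: eq_bigr => j _; rewrite linearZ.
Qed.

(** The chain rule is written as a sum over coordinates, so that derivatives of
    a composite are sums of products of the functions of the induction. *)
Lemma Ck_comp k U (U' : set 'rV[R]_m) h (f : 'rV[R]_m -> R) : open U ->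
  (forall x, U x -> U' (h x)) -> Ck k U h -> Ck k U' f -> Ck k U (f \o h).
Proof.
move=> oU hU; elim: k f => [|k IH] f.
  by move=> ch cf x Ux; apply: continuous_comp; [exact: ch|apply/cf/hU].
move=> ch [df ddf]; have [dh ddh] := ch.
have dfh x : U x -> differentiable f (h x) by move=> /hU /df.
split=> [x Ux|v]; first by apply: differentiable_comp; [exact: dh|exact: dfh].
pose G x := \sum_j ('d h x v) 0 j * 'd f (h x) (delta_mx 0 j).
have GE x : U x -> G x = 'd (f \o h) x v.
  move=> Ux; rewrite /G -diff_row_sum.
  exact/esym/(congr1 (fun l => l v) (diff_comp (dh x Ux) (dfh x Ux))).
apply: (Ck_ext oU GE); apply: (Ck_sum _ oU) => j.
have c1 := Ck_coord j oU (ddh v).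
have c2 := IH (fun y => 'd f y (delta_mx 0 j)) (Ck_pred ch) (ddf _).
exact: (Ck_mul oU c1 c2).
Qed.

End Composition.

(** * A flat smooth function *)

Section Flat.
Variable R : realType.
Implicit Types (P : {poly R}) (s : R).

(** Bound each monomial by [x ^+ i <= i! * expR x]. *)
Lemma horner_le_expR P :
  exists2 C : R, 0 <= C & forall x, 0 <= x -> `|P.[x]| <= C * expR x.
Proof.
exists (\sum_(i < size P) `|P`_i| * i`!%:R).
  by apply: sumr_ge0 => i _; rewrite mulr_ge0.
move=> x x0; rewrite horner_coef mulr_suml.
apply: le_trans (ler_norm_sum _ _ _) _; apply: ler_sum => i _.
rewrite normrM -mulrA ler_wpM2l // ger0_norm ?exprn_ge0 //.
have fi : 0 < (nat_of_ord i)`!%:R :> R by rewrite ltr0n fact_gt0.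
rewrite -ler_pdivrMl // mulrC.
case: (nat_of_ord i) => [|k]; first by rewrite expr0 divr1 -expR0 ler_expR.
by apply: le_trans (expR_ge1Dxn k x0); rewrite lerDr.
Qed.

(** The polynomial factor makes the family closed under differentiation. *)
Definition flat P s : R := if 0 < s then P.[s^-1] * expR (- s^-1) else 0.

Lemma flat_le0 P s : s <= 0 -> flat P s = 0.
Proof. by move=> s0; rewrite /flat ltNge s0. Qed.

Lemma flat_is_derive P s : 0 < s -> is_derive s 1
  (fun s : R => P.[s^-1] * expR (- s^-1))
  (('X^2 * (P - P^`())).[s^-1] * expR (- s^-1)).
Proof.
move=> s0; have s1 : s != 0 by rewrite gt_eqF.
have dinv : is_derive s 1 (fun s : R => s^-1) (- s^-2).
  apply: DeriveDef; first by apply: derivableV => //; apply: derivable_id.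
  by rewrite deriveV // derive_id /GRing.scale /= mulr1.
have dP : is_derive s 1 (fun s : R => P.[s^-1]) (P^`().[s^-1] * - s^-2).
  have := @is_derive1_comp _ (horner P) (fun s : R => s^-1) s _ _ (is_derive_poly P _) dinv.
  exact.
have dE : is_derive s 1 (fun s : R => expR (- s^-1)) (expR (- s^-1) * s^-2).
  have dN : is_derive s 1 (fun s : R => - s^-1) (s^-2).
    by apply: is_derive_eq; rewrite opprK.
  exact: (@is_derive1_comp _ expR (fun s : R => - s^-1) s _ _ (is_derive_expR _) dN).
have dM := is_deriveM dP dE.
apply: (@is_derive_eq _ _ _ _ _ _ _ _ dM).
rewrite hornerM hornerXn hornerD hornerN /GRing.scale /= -exprVn; ring.
Qed.

(** Only the origin needs an argument: there [flat P h] is [O(h ^+ 2)], by the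
    exponential bound applied to ['X^2 * P] at [h^-1]. *)
Lemma flat_diff P s : differentiable (flat P) s /\
  forall h, 'd (flat P) s h = h * flat ('X^2 * (P - P^`())) s.
Proof.
have [s_lt0|s_gt0|->] := ltgtP s 0.
- have near0 : \forall t \near s, flat P t = 0.
    near=> t; apply: flat_le0; apply: ltW; near: t; exact: lt_nbhsl.
  have [dP dP0] := near_zero_diff near0; split=> // h.
  by rewrite (flat_le0 _ (ltW s_lt0)) mulr0 dP0.
- have nearE : \forall t \near s, P.[t^-1] * expR (- t^-1) = flat P t.
    by near=> t; rewrite /flat ifT //; near: t; exact: lt_nbhsr.
  have dF := flat_is_derive P s_gt0.
  have dfF : differentiable (fun t : R => P.[t^-1] * expR (- t^-1)) s.
    by apply/derivable1_diffP; exact: ex_derive.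
  have [dP dPE] := near_eq_diff nearE dfF; split=> // h.
  apply: etrans (congr1 (fun l => l h) dPE) _.
  have dF1 : derivable (fun t : R => P.[t^-1] * expR (- t^-1)) s 1 by [].
  apply: etrans (congr1 (fun l => l h) (deriv1E dF1)) _.
  by rewrite derive1E (@derive_val _ _ _ _ _ _ _ dF) /flat s_gt0.
- have [C C0 HC] := horner_le_expR ('X^2 * P).
  (* C may be zero, and the bound e / (C + 1) below must make sense. *)
  have C1 : 0 < C + 1 by rewrite ltr_wpDl.
  have E : flat P \o shift 0 = cst (flat P 0) + (0 : R -> R) +o_ (0 : R) id.
    apply/eqaddoP => e e0; near=> h.
    rewrite addr0 !fctE /= addr0 (flat_le0 _ (lexx 0)) subr0.
    have [h_gt0|h_le0] := ltP 0 h; last first.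
      by rewrite flat_le0 // normr0 mulr_ge0 // ltW.
    have x0 : 0 <= h^-1 by rewrite invr_ge0 ltW.
    have := HC _ x0; rewrite hornerM hornerXn => HCh.
    have : `|flat P h| <= C * h ^+ 2.
      rewrite /flat h_gt0 normrM (ger0_norm (expR_ge0 _)) expRN.
      rewrite ler_pdivrMr ?expR_gt0 // mulrAC -ler_pdivrMr ?exprn_gt0 //.
      by rewrite mulrC -exprVn -(@ger0_norm _ (h^-1 ^+ 2)) ?exprn_ge0 // -normrM.
    move=> /le_trans; apply; rewrite (ger0_norm (ltW h_gt0)) expr2 mulrA.
    rewrite ler_wpM2r ?(ltW h_gt0) //.
    apply: (@le_trans _ _ ((C + 1) * h)); first by rewrite ler_wpM2r ?(ltW h_gt0) // lerDl.
    rewrite -ler_pdivlMl // mulrC; apply: ltW; near: h.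
    exact: lt_nbhsl (divr_gt0 e0 C1).
  have D0 : 'd (flat P) 0 = 0 :> (R -> R).
    by apply: diff_unique => //; apply: cst_continuous.
  split=> [|h]; last by rewrite D0 flat_le0 // mulr0.
  apply/diff_locallyP; rewrite D0; split=> //; exact: cst_continuous.
Unshelve. all: by end_near. Qed.

Lemma Ck_flat (V : normedModType R) k (U : set V) (u : V -> R) P : open U ->
  Ck k U u -> Ck k U (fun x => flat P (u x)).
Proof.
move=> oU; elim: k P => [|k IH] P.
  move=> cu x Ux; apply: (@continuous_comp _ _ _ u (flat P)); first exact: cu.
  by apply: differentiable_continuous; have [] := flat_diff P (u x).
move=> cu; have [du ddu] := cu; split=> [x Ux|v].
  by apply: (differentiable_comp (du x Ux)); have [] := flat_diff P (u x).
have E x : U x -> 'd u x v * flat ('X^2 * (P - P^`())) (u x) =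
    'd (fun x => flat P (u x)) x v.
  move=> Ux; have [dP dPE] := flat_diff P (u x).
  apply: etrans (esym (dPE _)) _.
  exact: (esym (congr1 (fun l => l v) (diff_comp (du x Ux) dP))).
apply: (Ck_ext oU E); apply: (Ck_mul oU (ddu v)).
exact: IH (Ck_pred cu).
Qed.

Lemma flat1_gt0 s : (0 < flat 1 s) = (0 < s).
Proof.
by rewrite /flat; case: ifP; rewrite ?ltxx // hornerC mul1r expR_gt0.
Qed.

End Flat.

(** * Smooth functions and tangent vectors on manifolds *)

Section SmoothFunctions.
Variables (R : realType) (n : nat) (M : manifold R n).
Implicit Types (f g : M -> R) (c d : chart R n M).

Lemma open_chart_image c (A : set M) : atlas c -> open A ->
  open (cmap c @` (cdom c `&` A)).
Proof.
move=> /atlas_chart[oc oi cK _ ci] oA; rewrite openE => _ [x [cx Ax] <-].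
have iy : cimg c (cmap c x) by exists x.
have nc : \forall y \near cmap c x, (cdom c `&` A) (cinv c y).
  apply: (ci _ iy); rewrite cK //.
  by apply: open_nbhs_nbhs; split; [exact: openI|].
rewrite /interior /=; near=> y.
have : cimg c y by near: y; exact: open_nbhs_nbhs.
case=> w cw wy; exists w => //; have [_ Aw] : (cdom c `&` A) (cinv c y) by near: y.
by split=> //; rewrite -(cK w cw) wy.
Unshelve. all: by end_near. Qed.

Lemma chart_image_sub c (A : set M) : cmap c @` (cdom c `&` A) `<=` cimg c.
Proof. by move=> _ [x [cx _] <-]; exists x. Qed.

(** The transition maps are smooth, so one chart around each point controls all
    the others. *)
Lemma smooth_local f :
  (forall x, exists c (U : set M), [/\ atlas c, cdom c x, open U, U x &
     smooth_on (cmap c @` (cdom c `&` U)) (f \o cinv c)]) -> smooth f.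
Proof.
move=> H d ad k; have [od oid dK cd ci] := atlas_chart ad.
apply: Ck_local => _ [q dq <-].
have [c [U [ac cq oU Uq fU]]] := H q.
have [oc oic cK _ _] := atlas_chart ac.
exists (cmap d @` (cdom d `&` (cdom c `&` U))); first by exists q.
have oV : open (cmap d @` (cdom d `&` (cdom c `&` U))).
  by apply: open_chart_image => //; exact: openI.
apply: (@Ck_ext _ _ _ k _ ((f \o cinv c) \o (cmap c \o cinv d))) => //.
  by move=> _ [z [dz [cz _]] <-] /=; rewrite dK // cK.
apply: (Ck_comp oV _ _ (fU k)).
  by move=> _ [z [dz [cz Uz]] <-]; exists z => //=; rewrite dK.
apply: Ck_sub (atlas_compat ad ac k).
by move=> _ [z [dz [cz _]] <-]; exists z.
Qed.

Lemma smooth_continuous f : smooth f -> continuous f.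
Proof.
move=> sf x; have [c ac cx] := atlas_cover x.
have [oc oic cK cc ci] := atlas_chart ac.
have ix : cimg c (cmap c x) by exists x.
have cfc : {for cmap c x, continuous (f \o cinv c)} by exact: Ck_continuous (sf c ac 0%N) _ ix.
have : {for x, continuous ((f \o cinv c) \o cmap c)}.
  by apply: continuous_comp => //; exact: cc.
rewrite /prop_for /continuous_at /= cK //; apply: cvg_trans.
apply: near_eq_cvg; apply: filterS (open_nbhs_nbhs (conj oc cx)) => y cy /=.
by rewrite cK.
Qed.

Lemma smooth_cst (a : R) : smooth (fun _ : M => a).
Proof. by move=> c _ k; exact: Ck_cst. Qed.

Lemma smoothD f g : smooth f -> smooth g -> smooth (fun x => f x + g x).
Proof.
move=> sf sg c ac k; have [_ oi _ _ _] := atlas_chart ac.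
exact: Ck_add (sf c ac k) (sg c ac k).
Qed.

Lemma smoothM f g : smooth f -> smooth g -> smooth (fun x => f x * g x).
Proof.
move=> sf sg c ac k; have [_ oi _ _ _] := atlas_chart ac.
exact: Ck_mul (sf c ac k) (sg c ac k).
Qed.

Lemma smoothN f : smooth f -> smooth (fun x => - f x).
Proof.
move=> sf; rewrite (_ : (fun _ => _) = fun x => -1 * f x).
  by apply: smoothM sf; exact: smooth_cst.
by apply/funext => x; rewrite mulN1r.
Qed.

Lemma smoothB f g : smooth f -> smooth g -> smooth (fun x => f x - g x).
Proof. by move=> sf /smoothN sg; exact: smoothD. Qed.

Lemma smooth_sum (I : Type) (r : seq I) (P : pred I) (F : I -> M -> R) :
  (forall i, smooth (F i)) -> smooth (fun x => \sum_(i <- r | P i) F i x).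
Proof.
move=> sF; elim: r => [|i r IH].
  by under eq_fun do rewrite big_nil; exact: smooth_cst.
under eq_fun do rewrite big_cons; case: (P i) => //; exact: smoothD.
Qed.

Lemma smooth_prod (I : Type) (r : seq I) (F : I -> M -> R) :
  (forall i, smooth (F i)) -> smooth (fun x => \prod_(i <- r) F i x).
Proof.
move=> sF; elim: r => [|i r IH].
  by under eq_fun do rewrite big_nil; exact: smooth_cst.
by under eq_fun do rewrite big_cons; exact: smoothM.
Qed.

(** The formulas found below for a function often hold only after multiplication
    by a bump function or by a Gram determinant; the denominator is allowed to
    depend on the point so that they can be divided out. *)
Lemma smooth_quotient f :
  (forall x, exists d s : M -> R,
     [/\ smooth d, smooth s, d x != 0 & forall y, d y * f y = s y]) ->
  smooth f.
Proof.
move=> H; apply: smooth_local => x; have [d [s [sd ss dx E]]] := H x.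
have [c ac cx] := atlas_cover x; have [oc oic cK _ _] := atlas_chart ac.
have oU : open [set y | d y != 0].
  have -> : [set y | d y != 0] = d @^-1` [set t | t != 0] by [].
  apply: open_comp; first by move=> y _; exact: smooth_continuous.
  exact: open_neq.
exists c, [set y | d y != 0]; split=> // k.
have oV := open_chart_image ac oU.
apply: (@Ck_ext _ _ _ k _ (fun y => (d (cinv c y))^-1 * s (cinv c y))) => //.
  by move=> _ [z [cz dz] <-] /=; rewrite cK // -E mulKf.
apply: Ck_mul => //; last first.
  exact: Ck_sub (@chart_image_sub _ _) (ss c ac k).
apply: Ck_inv => //; first by move=> _ [z [cz dz] <-] /=; rewrite cK.
exact: Ck_sub (@chart_image_sub _ _) (sd c ac k).
Qed.

End SmoothFunctions.

Section SmoothMaps.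
Variables (R : realType) (m n : nat) (M : manifold R m) (N : manifold R n).

Lemma smooth_comp (F : M -> N) (f : N -> R) :
  smooth_map F -> smooth f -> smooth (f \o F).
Proof.
move=> [cF sF] sf; apply: smooth_local => x.
have [c ac cx] := atlas_cover x; have [d ad dFx] := atlas_cover (F x).
have [oc oic cK _ _] := atlas_chart ac; have [od oid dK _ _] := atlas_chart ad.
have oU : open (F @^-1` cdom d) by apply: open_comp => // y _; exact: cF.
exists c, (F @^-1` cdom d); split=> // k.
have oV := open_chart_image ac oU.
apply: (@Ck_ext _ _ _ k _ ((f \o cinv d) \o (cmap d \o F \o cinv c))) => //.
  by move=> _ [z [cz dz] <-] /=; rewrite cK // dK.
apply: (Ck_comp oV _ (sF c d ac ad k) (sf d ad k)).
by move=> _ [z [cz dz] <-]; exists (F z) => //=; rewrite cK.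
Qed.

End SmoothMaps.

Lemma smooth_map_id (R : realType) (n : nat) (M : manifold R n) :
  smooth_map (id : M -> M).
Proof.
split=> [x|c d ac ad]; first by apply: cvg_id.
exact: (atlas_compat ac ad).
Qed.

Section Tangent.
Variables (R : realType) (n : nat) (M : manifold R n).
Implicit Types (f g : M -> R) (c d : chart R n M) (u v : tvec R M).

Definition chart_vector c (p : M) (a : 'rV[R]_n) : tvec R M :=
  fun f => if `[< smooth f >] then 'd (f \o cinv c) (cmap c p) a else 0.

Lemma chart_vectorE c p a f : smooth f -> chart_vector c p a f = 'd (f \o cinv c) (cmap c p) a.
Proof. by move=> sf; rewrite /chart_vector asboolT. Qed.

Lemma chart_vector_tangent c p a : atlas c -> cdom c p -> tangent p (chart_vector c p a).
Proof. by exists c, a. Qed.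

Lemma chart_diff c p f : atlas c -> cdom c p -> smooth f ->
  differentiable (f \o cinv c) (cmap c p).
Proof. by move=> ac cp sf; have [df _] := sf c ac 1%N; apply: df; exists p. Qed.

Lemma chart_vector_lin c p a b b' :
  chart_vector c p (a *: b + b') =
  a *: chart_vector c p b + chart_vector c p b'.
Proof.
apply/funext => f; rewrite !fctE /chart_vector; case: ifP => _.
  by rewrite linearP.
by rewrite scaler0 addr0.
Qed.

End Tangent.

Section TangentMap.
Variables (R : realType) (m n : nat) (M : manifold R m) (N : manifold R n).

Lemma tmapE (F : M -> N) v f : smooth f -> tmap F v f = v (f \o F).
Proof. by move=> sf; rewrite /tmap asboolT. Qed.

(** The chain rule in charts.  With the identity for [F] it is the change of
    charts for tangent vectors. *)
Lemma tmap_chart_vector (F : M -> N) c d x a : smooth_map F ->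
  atlas c -> atlas d -> cdom c x -> cdom d (F x) ->
  tmap F (chart_vector c x a) = chart_vector d (F x) ('d (cmap d \o F \o cinv c) (cmap c x) a).
Proof.
move=> sF ac ad cx dFx; apply/funext => f; rewrite /tmap {2}/chart_vector.
case: ifPn => // /asboolP sf; rewrite chart_vectorE; last exact: smooth_comp.
have [oc oic cK _ _] := atlas_chart ac; have [od oid dK _ _] := atlas_chart ad.
have oU : open (F @^-1` cdom d).
  by apply: open_comp => // y _; apply: (proj1 sF).
have oV := open_chart_image ac oU.
have Vx : (cmap c @` (cdom c `&` F @^-1` cdom d)) (cmap c x) by exists x.
have [dF _] := (proj2 sF) c d ac ad 1%N.
have df := chart_diff ad dFx sf.
pose h := cmap d \o F \o cinv c.
have hx : h (cmap c x) = cmap d (F x) by rewrite /h /= cK.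
have dh : differentiable h (cmap c x) by exact: dF.
have df' : differentiable (f \o cinv d) (h (cmap c x)) by rewrite hx.
have nE : \forall y \near cmap c x, ((f \o cinv d) \o h) y = (f \o F \o cinv c) y.
  apply: filterS (open_nbhs_nbhs (conj oV Vx)) => _ [z [cz dz] <-].
  by rewrite /h /= cK // dK.
have [_ E] := near_eq_diff nE (differentiable_comp dh df').
apply: etrans (congr1 (fun l => l a) E) _.
apply: etrans (congr1 (fun l => l a) (diff_comp dh df')) _.
by rewrite [LHS]/= hx.
Qed.

Lemma tangent_tmap (F : M -> N) x v : smooth_map F -> tangent x v ->
  tangent (F x) (tmap F v).
Proof.
move=> sF [c [a [ac cx ->]]]; have [d ad dFx] := atlas_cover (F x).
by rewrite (tmap_chart_vector a sF ac ad cx dFx); exact: chart_vector_tangent.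
Qed.

Lemma tmap_lin (F : M -> N) a u v :
  tmap F (a *: u + v) = a *: tmap F u + tmap F v.
Proof.
apply/funext => f; rewrite /tmap !fctE; case: ifP => // _.
by rewrite scaler0 addr0.
Qed.

Lemma tmap0 (F : M -> N) : tmap F (0 : tvec R M) = 0.
Proof. by apply/funext => f; rewrite /tmap; case: ifP. Qed.

Lemma tmapN (F : M -> N) (u : tvec R M) : tmap F (- u) = - tmap F u.
Proof.
by apply/funext => f; rewrite /tmap !fctE; case: ifP => // _; rewrite oppr0.
Qed.

Lemma tmapD (F : M -> N) (u v : tvec R M) : tmap F (u + v) = tmap F u + tmap F v.
Proof. by rewrite -[u in LHS]scale1r tmap_lin scale1r. Qed.

End TangentMap.

Section TangentSpace.
Variables (R : realType) (n : nat) (M : manifold R n).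
Implicit Types (f g : M -> R) (c d : chart R n M) (u v : tvec R M).

Lemma tangent_nonsmooth p v f : tangent p v -> ~ smooth f -> v f = 0.
Proof. by move=> [c [a [_ _ ->]]] nf; rewrite asboolF. Qed.

Lemma tmap_id p v : tangent p v -> tmap (id : M -> M) v = v.
Proof.
move=> tv; apply/funext => f; rewrite /tmap; case: ifPn => // /asboolP nf.
by rewrite (tangent_nonsmooth tv).
Qed.

Lemma tangent_chart c p v : tangent p v -> atlas c -> cdom c p ->
  exists a, v = chart_vector c p a.
Proof.
move=> tv ac cp; have := tmap_id tv.
have [d [a [ad dp ->]]] := tv; rewrite -/(chart_vector d p a) => <-.
eexists; exact: (tmap_chart_vector a (@smooth_map_id _ _ M) ad ac dp cp).
Qed.

Lemma tangent_lin p a u v : tangent p u -> tangent p v -> tangent p (a *: u + v).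
Proof.
move=> tu tv; have [c ac cp] := atlas_cover p.
have [b ->] := tangent_chart tu ac cp; have [b' ->] := tangent_chart tv ac cp.
by rewrite -chart_vector_lin; exact: chart_vector_tangent.
Qed.

Lemma tangent0 p : tangent p (0 : tvec R M).
Proof.
have [c ac cp] := atlas_cover p.
rewrite (_ : 0 = chart_vector c p 0); first exact: chart_vector_tangent.
by apply/funext => f; rewrite /chart_vector; case: ifP => // _; rewrite linear0.
Qed.

Lemma tangentZ p a u : tangent p u -> tangent p (a *: u).
Proof. by move=> tu; rewrite -[_ *: _]addr0; apply: tangent_lin tu (tangent0 p). Qed.

Lemma tangentD p u v : tangent p u -> tangent p v -> tangent p (u + v).
Proof. by move=> tu; rewrite -[u in u + v]scale1r; exact: tangent_lin. Qed.

Lemma tangentN p u : tangent p u -> tangent p (- u).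
Proof. by rewrite -scaleN1r; exact: tangentZ. Qed.

Lemma tangentB p u v : tangent p u -> tangent p v -> tangent p (u - v).
Proof. by move=> tu /tangentN; exact: tangentD. Qed.

Lemma tangent_sum p (I : Type) (r : seq I) (a : I -> R) (u : I -> tvec R M) :
  (forall i, tangent p (u i)) -> tangent p (\sum_(i <- r) a i *: u i).
Proof.
move=> tu; elim: r => [|i r IH]; first by rewrite big_nil; exact: tangent0.
by rewrite big_cons; apply: tangent_lin.
Qed.

Lemma tangent_derivD p v f g : tangent p v -> smooth f -> smooth g ->
  v (fun x => f x + g x) = v f + v g.
Proof.
move=> tv sf sg; have [c ac cp] := atlas_cover p.
have [a ->] := tangent_chart tv ac cp.
rewrite !chart_vectorE //; last exact: smoothD.
exact: (congr1 (fun l => l a) (diffD (chart_diff ac cp sf) (chart_diff ac cp sg))).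
Qed.

Lemma tangent_derivM p v f g : tangent p v -> smooth f -> smooth g ->
  v (fun x => f x * g x) = f p * v g + g p * v f.
Proof.
move=> tv sf sg; have [c ac cp] := atlas_cover p.
have [a ->] := tangent_chart tv ac cp.
have [_ _ cK _ _] := atlas_chart ac.
rewrite !chart_vectorE //; last exact: smoothM.
have := congr1 (fun l => l a) (diffM (chart_diff ac cp sf) (chart_diff ac cp sg)).
by rewrite /= cK.
Qed.

Lemma tangent_deriv_cst p v (a : R) : tangent p v -> v (fun _ => a) = 0.
Proof.
move=> tv; have [c ac cp] := atlas_cover p.
have [b ->] := tangent_chart tv ac cp; rewrite chart_vectorE; last exact: smooth_cst.
exact: (congr1 (fun l => l b) (diff_cst a (cmap c p))).
Qed.

End TangentSpace.

(** * Bump functions and frames of global fields *)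

Section Extension.
Variables (R : realType) (n : nat) (M : manifold R n).
Implicit Types (f g : M -> R) (u : 'rV[R]_n -> R).

Definition ext0 (T : nmodType) (c : chart R n M) (h : M -> T) : M -> T :=
  fun q => if `[< cdom c q >] then h q else 0.

Lemma ext0_in (T : nmodType) (c : chart R n M) (h : M -> T) q : cdom c q -> ext0 c h q = h q.
Proof. by move=> cq; rewrite /ext0 asboolT. Qed.

Lemma ext0_out (T : nmodType) (c : chart R n M) (h : M -> T) q : ~ cdom c q -> ext0 c h q = 0.
Proof. by move=> cq; rewrite /ext0 asboolF. Qed.

(** This is where the Hausdorff axiom enters: the image of the compact set [K]
    in the manifold is closed, so the extension is zero near every point
    outside the chart. *)
Lemma smooth_ext0 (c : chart R n M) (K : set 'rV[R]_n) u h : atlas c -> compact K ->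
  K `<=` cimg c -> smooth_on (cimg c) u -> (forall y, ~ K y -> u y = 0) ->
  (forall q, cdom c q -> h q = u (cmap c q)) ->
  smooth (ext0 c h : M -> R).
Proof.
move=> ac cK Kc su u0 hu; have [oc oic ciK cc ci] := atlas_chart ac.
apply: smooth_local => x; have [cx|ncx] := pselect (cdom c x).
  exists c, setT; split=> // [|k]; first exact: openT.
  rewrite setIT; apply: (@Ck_ext _ _ _ k _ u) => //.
  by move=> _ [z cz <-] /=; rewrite ciK // ext0_in // hu.
have [d ad dx] := atlas_cover x; have [od oid dK _ _] := atlas_chart ad.
have cl : closed (cinv c @` K).
  apply: compact_closed; first exact: manifold_hausdorff.
  apply: continuous_compact => //; apply: continuous_in_subspaceT => y.
  by rewrite inE => /Kc; exact: ci.
exists d, (~` (cinv c @` K)); split=> // [||k].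
- exact: closed_openC.
- by move=> [y Ky yx]; apply: ncx; rewrite -yx; have [z cz <-] := Kc _ Ky; rewrite ciK.
- apply: (@Ck_ext _ _ _ k _ (cst 0)); last exact: Ck_cst.
    by apply: open_chart_image => //; exact: closed_openC.
  move=> _ [z [dz nz] <-] /=; rewrite dK //.
  have [cz|ncz] := pselect (cdom c z); last by rewrite ext0_out.
  rewrite ext0_in // hu // u0 // => Kz; apply: nz; exists (cmap c z) => //.
  exact: ciK.
Qed.

(** The norm of ['rV_n] is the maximum norm, which is not smooth; the bump is a
    flat function of the sum of squares, and it is supported in a box. *)
Lemma flat_bump (y0 : 'rV[R]_n) (W : set 'rV[R]_n) : open W -> W y0 ->
  exists (rho : 'rV[R]_n -> R) (K : set 'rV[R]_n),
    [/\ forall U, open U -> smooth_on U rho, rho y0 != 0, compact K, K `<=` W &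
        forall y, ~ K y -> rho y = 0].
Proof.
move=> oW Wy0; have /nbhs_ballP[e /= e0 eW] := open_nbhs_nbhs (conj oW Wy0).
have e2 : 0 < e / 2 by rewrite divr_gt0.
pose q (y : 'rV[R]_n) := \sum_j (y 0 j - y0 0 j) * (y 0 j - y0 0 j).
pose rho y := flat 1 ((e / 2) ^+ 2 - q y).
exists rho, [set y : 'rV[R]_n | forall j, `[y0 0 j - e / 2, y0 0 j + e / 2]%classic (y ord0 j)].
split.
- move=> U oU k; apply: Ck_flat => //.
  have Cq : Ck k U q.
    apply: Ck_sum => // j; have Cj : Ck k U (fun y : 'rV[R]_n => y 0 j - y0 0 j).
      apply: Ck_add => //; last exact: Ck_cst.
      by apply: Ck_coord => //; exact: Ck_id.
    exact: Ck_mul.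
  have CN : Ck k U (fun y => -1 * q y) by apply: Ck_mul => //; exact: Ck_cst.
  apply: (@Ck_ext _ _ _ k _ (fun y => (e / 2) ^+ 2 + -1 * q y)) => //.
    by move=> y _; rewrite mulN1r.
  by apply: Ck_add => //; exact: Ck_cst.
- rewrite gt_eqF // flat1_gt0 /q big1 ?subr0 ?exprn_gt0 // => j _.
  by rewrite subrr mulr0.
- apply: (rV_compact (A := fun j => `[y0 0 j - e / 2, y0 0 j + e / 2]%classic)) => j.
  exact: segment_compact.
- move=> y Ky; apply: eW; split=> // i j; rewrite ord1.
  have := Ky j; rewrite /= in_itv /= => /andP[l1 l2].
  rewrite /ball /= ltr_norml; apply/andP; split; lra.
- move=> y nK; rewrite /rho flat_le0 // subr_le0 leNgt; apply/negP => lt; apply: nK => j.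
  rewrite /= in_itv /=.
  have : (y 0 j - y0 0 j) ^+ 2 < (e / 2) ^+ 2.
    apply: le_lt_trans lt; rewrite /q (bigD1 j) //= expr2 lerDl.
    by apply: sumr_ge0 => i _; rewrite -expr2 sqr_ge0.
  rewrite -[ltLHS]real_normK ?num_real // ltr_pXn2r ?nnegrE ?normr_ge0 ?(ltW e2) //.
  rewrite ltr_norml => /andP[l1 l2]; apply/andP; split; lra.
Qed.

Lemma smooth_bump (x : M) (U : set M) : nbhs x U ->
  exists f : M -> R, [/\ smooth f, f x != 0 & forall y, ~ U y -> f y = 0].
Proof.
rewrite nbhsE => -[B [oB Bx] BU].
have [c ac cx] := atlas_cover x; have [oc oic cK _ _] := atlas_chart ac.
have oW := open_chart_image ac oB.
have Wx : (cmap c @` (cdom c `&` B)) (cmap c x) by exists x.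
have [rho [K [srho rho0 cptK KW rhoK]]] := flat_bump oW Wx.
exists (ext0 c (rho \o cmap c)); split.
- apply: (smooth_ext0 ac cptK _ (srho _ oic)) => //.
  by apply: subset_trans KW _; exact: chart_image_sub.
- by rewrite ext0_in.
- move=> y nUy; have [cy|ncy] := pselect (cdom c y); last by rewrite ext0_out.
  rewrite ext0_in //= rhoK // => /KW [z [cz Bz]] zy; apply: nUy; apply: BU.
  by rewrite -(cK _ cy) -zy cK.
Qed.

(** In the chart of [p] with coordinates [y_i], take for [f] a bump function,
    [E i = f d/dy_i] and [psi i = f y_i].  The Leibniz rule gives
    [f * w (psi i) - psi i * w f = f ^+ 2 * w_i], in which the derivative of [f]
    has cancelled; multiplying by [E i] yields the expansion of [f ^+ 3 *: w].
    Outside the chart all the terms are zero. *)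
Lemma bump_frame (p : M) :
  exists (f : M -> R) (E : 'I_n -> M -> tvec R M) (psi : 'I_n -> M -> R),
  [/\ [/\ smooth f, f p != 0 & forall i, smooth (psi i)],
      forall i, vfield (E i),
      forall q w, tangent q w -> f q ^+ 3 *: w =
        \sum_i (f q * w (psi i) - psi i q * w f) *: E i q &
      forall q i j, f q * E i q (psi j) - psi j q * E i q f =
        f q ^+ 3 * (i == j)%:R].
Proof.
have [c ac cp] := atlas_cover p; have [oc oic cK cc ci] := atlas_chart ac.
have ip : cimg c (cmap c p) by exists p.
have [rho [K [srho rho0 cptK Kc rhoK]]] := flat_bump oic ip.
have coord_smooth j : smooth_on (cimg c) (fun y : 'rV[R]_n => y 0 j).
  move=> k; apply: Ck_coord => //.
  exact: Ck_id.
pose f := ext0 c (rho \o cmap c).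
pose psi i := ext0 c (fun q => rho (cmap c q) * cmap c q 0 i).
pose E (i : 'I_n) := ext0 c (fun q => rho (cmap c q) *: chart_vector c q (delta_mx 0 i)).
have sf : smooth f by apply: (smooth_ext0 ac cptK Kc (srho _ oic)).
have spsi i : smooth (psi i).
  apply: (@smooth_ext0 c K (fun y => rho y * y 0 i)) => //.
    by move=> k; apply: Ck_mul => //; [exact: srho|exact: coord_smooth].
  by move=> y /rhoK ->; rewrite mul0r.
have L q a i : cdom c q ->
    f q * chart_vector c q a (psi i) - psi i q * chart_vector c q a f = f q ^+ 2 * a 0 i.
  move=> cq; rewrite !chart_vectorE //; have dff := chart_diff ac cq sf.
  have did : differentiable (@id 'rV[R]_n) (cmap c q) by apply: ex_diff.
  have [dci dciE] := diff_coord i a did.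
  have iq : cimg c (cmap c q) by exists q.
  have nE : \forall z \near cmap c q,
      ((f \o cinv c) * (fun y : 'rV[R]_n => y 0 i)) z = (psi i \o cinv c) z.
    apply: filterS (open_nbhs_nbhs (conj oic iq)) => _ [z cz <-].
    by rewrite fctE /= cK // /f /psi !ext0_in.
  have [_ dE] := near_eq_diff nE (differentiableM dff dci).
  have dpsi : 'd (psi i \o cinv c) (cmap c q) a =
      f q * a 0 i + cmap c q 0 i * 'd (f \o cinv c) (cmap c q) a.
    apply: etrans (congr1 (fun l => l a) dE) _.
    apply: etrans (congr1 (fun l => l a) (diffM dff dci)) _.
    rewrite diff_idE in dciE.
    by rewrite [LHS]/= cK //; congr (_ * _ + _); exact: dciE.
  have psiE : psi i q = f q * cmap c q 0 i by rewrite /f /psi !ext0_in.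
  by rewrite dpsi psiE; move: ('d _ _ _) => D; ring.
exists f, E, psi; split=> //.
- by split=> //; rewrite /f ext0_in.
- move=> i; split=> [q|g sg].
    have [cq|ncq] := pselect (cdom c q).
      by rewrite /E ext0_in //; apply: tangentZ; exact: chart_vector_tangent.
    by rewrite /E ext0_out //; exact: tangent0.
  rewrite (_ : (fun q => _) = ext0 c (fun q => rho (cmap c q) * chart_vector c q (delta_mx 0 i) g)).
    apply: (@smooth_ext0 c K (fun y => rho y * 'd (g \o cinv c) y (delta_mx 0 i))) => //.
    + move=> k; apply: Ck_mul => //; first exact: srho.
      exact: (proj2 (sg c ac k.+1)).
    + by move=> y /rhoK ->; rewrite mul0r.
    + by move=> q cq; rewrite chart_vectorE.
  apply/funext => q; have [cq|ncq] := pselect (cdom c q).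
    by rewrite /E !ext0_in.
  by rewrite /E !ext0_out.
- move=> q w tw; have [cq|ncq] := pselect (cdom c q); last first.
    rewrite /f ext0_out // expr0n scale0r big1 // => i _.
    by rewrite /E ext0_out // scaler0.
  have [a ->] := tangent_chart tw ac cq.
  have aE : chart_vector c q a = \sum_i a 0 i *: chart_vector c q (delta_mx 0 i).
    rewrite {1}[a]row_sum_delta.
    elim: (index_enum _) => [|i r IH].
      rewrite !big_nil; apply/funext => g; rewrite /chart_vector.
      by case: ifP => // _; rewrite linear0.
    by rewrite !big_cons chart_vector_lin IH.
  rewrite [in LHS]aE scaler_sumr; apply: eq_bigr => i _.
  rewrite (L _ _ _ cq) /E /f !(ext0_in _ cq) /= !scalerA; congr (_ *: _); ring.
- move=> q i j; have [cq|ncq] := pselect (cdom c q); last first.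
    rewrite /f /psi !(ext0_out _ ncq) !mul0r subr0 expr0n.
    by rewrite mul0r.
  have fq : f q = rho (cmap c q) by rewrite /f ext0_in.
  have -> : E i q = f q *: chart_vector c q (delta_mx 0 i) by rewrite /E ext0_in // fq.
  have := L q (delta_mx 0 i) j cq; rewrite mxE eqxx /= eq_sym.
  rewrite !fctE /GRing.scale /= => H.
  by rewrite exprS -mulrA -H; ring.
Qed.

End Extension.

(** * Fields along a map and tensoriality *)

Lemma sum_apply (I T : Type) (U : nmodType) (r : seq I) (G : I -> T -> U) t :
  (\sum_(i <- r) G i) t = \sum_(i <- r) G i t.
Proof. by rewrite fct_sumE. Qed.

Section PointwiseAlgebra.
Variables (R : realType) (n : nat) (N : manifold R n).
Variables (phi : N -> tvec R N -> tvec R N) (g : N -> tvec R N -> tvec R N -> R).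
Hypothesis tphi : tensor11 phi.
Hypothesis rg : riemannian_metric g.

Lemma tensor11_lin p a u v : tangent p u -> tangent p v ->
  phi p (a *: u + v) = a *: phi p u + phi p v.
Proof. by case: tphi => _ + _; apply. Qed.

Lemma tensor11_0 p : phi p 0 = 0.
Proof.
have := tensor11_lin 1 (tangent0 p) (tangent0 p).
rewrite !scale1r addr0 => /eqP; rewrite -subr_eq subrr => /eqP <- //.
Qed.

Lemma tensor11_sum p (I : Type) (r : seq I) (a : I -> R) (u : I -> tvec R N) :
  (forall i, tangent p (u i)) ->
  phi p (\sum_(i <- r) a i *: u i) = \sum_(i <- r) a i *: phi p (u i).
Proof.
move=> tu; elim: r => [|i r IH]; first by rewrite !big_nil tensor11_0.
by rewrite !big_cons tensor11_lin ?IH //; exact: tangent_sum.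
Qed.

Lemma tensor11Z p a u : tangent p u -> phi p (a *: u) = a *: phi p u.
Proof.
move=> tu; have := tensor11_lin a tu (tangent0 p).
by rewrite tensor11_0 !addr0.
Qed.

Lemma tensor11D p u v : tangent p u -> tangent p v -> phi p (u + v) = phi p u + phi p v.
Proof. by move=> tu tv; have := tensor11_lin 1 tu tv; rewrite !scale1r. Qed.

Lemma tensor11N p u : tangent p u -> phi p (- u) = - phi p u.
Proof. by move=> tu; rewrite -scaleN1r tensor11Z // scaleN1r. Qed.

Lemma tensor11B p u v : tangent p u -> tangent p v -> phi p (u - v) = phi p u - phi p v.
Proof. by move=> tu tv; rewrite tensor11D ?tensor11N //; exact: tangentN. Qed.

Lemma metricDl p u v w : tangent p u -> tangent p v -> tangent p w ->
  g p (u + v) w = g p u w + g p v w.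
Proof.
case: rg => gl _ _ _ tu tv tw; have := gl p 1 u v w tu tv tw.
by rewrite scale1r mul1r.
Qed.

Lemma metricC p u v : tangent p u -> tangent p v -> g p u v = g p v u.
Proof. by case: rg => _ + _ _; apply. Qed.

Lemma metric0l p w : tangent p w -> g p 0 w = 0.
Proof.
move=> tw; have := metricDl (tangent0 p) (tangent0 p) tw.
by rewrite addr0 => /eqP; rewrite -subr_eq subrr => /eqP <-.
Qed.

Lemma metricZl p a u w : tangent p u -> tangent p w -> g p (a *: u) w = a * g p u w.
Proof.
case: rg => gl _ _ _ tu tw; have := gl p a u 0 w tu (tangent0 p) tw.
by rewrite metric0l // !addr0.
Qed.

Lemma metricNl p u w : tangent p u -> tangent p w -> g p (- u) w = - g p u w.
Proof. by move=> tu tw; rewrite -scaleN1r metricZl // mulN1r. Qed.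

Lemma metricBl p u v w : tangent p u -> tangent p v -> tangent p w ->
  g p (u - v) w = g p u w - g p v w.
Proof. by move=> tu tv tw; rewrite metricDl ?metricNl //; exact: tangentN. Qed.

Lemma metric_suml p (I : Type) (r : seq I) (a : I -> R) (u : I -> tvec R N) w :
  (forall i, tangent p (u i)) -> tangent p w ->
  g p (\sum_(i <- r) a i *: u i) w = \sum_(i <- r) a i * g p (u i) w.
Proof.
move=> tu tw; elim: r => [|i r IH]; first by rewrite !big_nil metric0l.
rewrite !big_cons metricDl ?metricZl ?IH //; first exact: tangentZ.
exact: tangent_sum.
Qed.

Lemma metricDr p u v w : tangent p u -> tangent p v -> tangent p w ->
  g p w (u + v) = g p w u + g p w v.
Proof.
move=> tu tv tw; rewrite metricC // ?metricDl //; last exact: tangentD.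
by rewrite (metricC tu tw) (metricC tv tw).
Qed.

Lemma metricZr p a u w : tangent p u -> tangent p w -> g p w (a *: u) = a * g p w u.
Proof.
move=> tu tw; rewrite metricC // ?metricZl // ?(metricC tu tw) //.
exact: tangentZ.
Qed.

Lemma metricNr p u w : tangent p u -> tangent p w -> g p w (- u) = - g p w u.
Proof. by move=> tu tw; rewrite -scaleN1r metricZr // mulN1r. Qed.

Lemma metric_sumr p (I : Type) (r : seq I) (a : I -> R) (u : I -> tvec R N) w :
  (forall i, tangent p (u i)) -> tangent p w ->
  g p w (\sum_(i <- r) a i *: u i) = \sum_(i <- r) a i * g p w (u i).
Proof.
move=> tu tw; rewrite metricC ?metric_suml //; last exact: tangent_sum.
by apply: eq_bigr => i _; rewrite metricC.
Qed.

Lemma metric_eq0 p u : tangent p u -> g p u u = 0 -> u = 0.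
Proof.
case: rg => _ _ gpos _ tu gu; apply: contrapT => /eqP u0.
by have := gpos p u tu u0; rewrite gu ltxx.
Qed.

Lemma metric_inj p u v : tangent p u -> tangent p v ->
  (forall w, tangent p w -> g p u w = g p v w) -> u = v.
Proof.
move=> tu tv E; apply/eqP; rewrite -subr_eq0; apply/eqP.
have tuv := tangentB tu tv.
by apply: (metric_eq0 tuv); rewrite metricBl // E // subrr.
Qed.

End PointwiseAlgebra.

Section AlongFields.
Variables (R : realType) (m n : nat) (M : manifold R m) (N : manifold R n).
Variable F : M -> N.
Hypothesis sF : smooth_map F.
Implicit Types (f : M -> R) (V W : M -> tvec R N).

Lemma along0 : vfield_along F (0 : M -> tvec R N).
Proof. by split=> [x|f sf]; [exact: tangent0|exact: smooth_cst]. Qed.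

Lemma alongD V W : vfield_along F V -> vfield_along F W -> vfield_along F (V + W).
Proof.
move=> [tV sV] [tW sW]; split=> [x|f sf]; first exact: tangentD.
by apply: smoothD; [exact: sV|exact: sW].
Qed.

Lemma alongZ f V : smooth f -> vfield_along F V -> vfield_along F (fscale f V).
Proof.
move=> sf [tV sV]; split=> [x|h sh]; first exact: tangentZ.
by apply: smoothM => //; exact: sV.
Qed.

Lemma along_sum (I : Type) (r : seq I) (V : I -> M -> tvec R N) :
  (forall i, vfield_along F (V i)) -> vfield_along F (\sum_(i <- r) V i).
Proof.
move=> aV; elim: r => [|i r IH]; first by rewrite big_nil; exact: along0.
by rewrite big_cons; exact: alongD.
Qed.

Lemma along_comp (Y : N -> tvec R N) : vfield Y -> vfield_along F (Y \o F).
Proof.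
move=> [tY sY]; split=> [x|f sf]; first exact: tY.
exact: (smooth_comp sF (sY f sf)).
Qed.

Lemma push_along (X : M -> tvec R M) : vfield X -> vfield_along F (push F X).
Proof.
move=> [tX sX]; split=> [x|f sf]; first exact: tangent_tmap.
rewrite (_ : (fun x => _) = fun x => X x (f \o F)); first exact/sX/smooth_comp.
by apply/funext => x; rewrite /push tmapE.
Qed.

(** The coefficients given by the frame of global fields involve only the
    functions [V psi], which are smooth by definition of a smooth field. *)
Lemma along_expand (p : N) : exists (f : N -> R) (E : 'I_n -> N -> tvec R N),
  [/\ smooth f, f p != 0, forall i, vfield (E i) &
   forall V, vfield_along F V -> exists c : 'I_n -> M -> R,
     [/\ forall i, smooth (c i),
         fscale (f \o F) V = \sum_i fscale (c i) (E i \o F) &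
         forall x, V x = 0 -> forall i, c i x = 0]].
Proof.
have [f [E [psi [[sf fp spsi] vE span _]]]] := bump_frame p.
exists (fun q => f q ^+ 3), E; split=> //.
- rewrite (_ : (fun q => _) = fun q => f q * (f q * f q)).
    by apply: smoothM => //; exact: smoothM.
  by apply/funext => q; rewrite !exprS mulr1.
- by rewrite expf_neq0.
move=> V [tV sV].
exists (fun i x => f (F x) * V x (psi i) - psi i (F x) * V x f); split.
- by move=> i; apply: smoothB; apply: smoothM; (try exact: sV); apply: (smooth_comp sF).
- apply/funext => x; rewrite /fscale /= span //.
  by rewrite sum_apply.
- move=> x V0 i.
  have V0E h : V x h = 0 by rewrite V0.
  by rewrite !V0E !mulr0 subr0.
Qed.

End AlongFields.

Section VectorFields.
Variables (R : realType) (n : nat) (M : manifold R n).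

Lemma vfieldD (X Y : M -> tvec R M) : vfield X -> vfield Y -> vfield (X + Y).
Proof. exact: (@alongD _ _ _ M M id). Qed.

Lemma vfieldZ f (X : M -> tvec R M) : smooth f -> vfield X -> vfield (fscale f X).
Proof. exact: (@alongZ _ _ _ M M id). Qed.

Lemma vfield_sum (I : Type) (r : seq I) (V : I -> M -> tvec R M) :
  (forall i, vfield (V i)) -> vfield (\sum_(i <- r) V i).
Proof. exact: (@along_sum _ _ _ M M id). Qed.

End VectorFields.

Lemma tangent_extend (R : realType) (n : nat) (N : manifold R n) (p : N) u :
  tangent p u -> exists2 Y, vfield Y & Y p = u.
Proof.
move=> tu; have [f [E [psi [[_ fp _] vE span _]]]] := bump_frame p.
have f3 : f p ^+ 3 != 0 by rewrite expf_neq0.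
pose a i := (f p ^+ 3)^-1 * (f p * u (psi i) - psi i p * u f).
exists (\sum_i fscale (fun _ => a i) (E i)).
  by apply: vfield_sum => i; apply: vfieldZ; first exact: smooth_cst.
rewrite sum_apply; apply: (scalerI f3); rewrite (span p u tu) scaler_sumr.
by apply: eq_bigr => i _; rewrite /fscale scalerA /a mulrA mulfV // mul1r.
Qed.

Section Tensoriality.
Variables (R : realType) (m n : nat) (M : manifold R m) (N : manifold R n).
Variable F : M -> N.
Hypothesis sF : smooth_map F.
Implicit Types (f : M -> R) (V W : M -> tvec R N).

(** Linearity over the smooth functions, which act on real numbers through
    their value at [x]. *)
Definition tensorial_at (x : M) (T : (M -> tvec R N) -> R) : Prop :=
  (forall V W, vfield_along F V -> vfield_along F W -> T (V + W) = T V + T W) /\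
  (forall f V, smooth f -> vfield_along F V -> T (fscale f V) = f x * T V).

(** Expand [V] along the frame of global fields: the coefficients vanish at [x]. *)
Lemma tensorial0 x T V : tensorial_at x T -> vfield_along F V -> V x = 0 -> T V = 0.
Proof.
move=> [TD TZ] aV V0; have [f [E [sf fp vE expand]]] := along_expand sF (F x).
have [c [sc VE c0]] := expand _ aV.
have T0 : T 0 = 0.
  have -> : 0 = fscale (fun _ => 0) V by apply/funext => y; rewrite /fscale scale0r.
  by rewrite TZ ?mul0r //; exact: smooth_cst.
have Tsum : T (\sum_i fscale (c i) (E i \o F)) = \sum_i c i x * T (E i \o F).
  have aE i : vfield_along F (fscale (c i) (E i \o F)).
    by apply: alongZ => //; exact: along_comp.
  elim: (index_enum _) => [|i r IH]; first by rewrite !big_nil.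
  rewrite !big_cons TD //; last exact: along_sum.
  by rewrite IH TZ //; exact: along_comp.
have : f (F x) * T V = 0.
  have <- := TZ (f \o F) V (smooth_comp sF sf) aV.
  by rewrite VE Tsum big1 // => i _; rewrite c0 // mul0r.
by move/eqP; rewrite mulf_eq0 (negPf fp) => /eqP.
Qed.

Lemma tensorial_eq x T V W : tensorial_at x T -> vfield_along F V ->
  vfield_along F W -> V x = W x -> T V = T W.
Proof.
move=> tT aV aW VW; have [TD TZ] := tT.
have sN1 := @smooth_cst _ _ M (-1).
have aN : vfield_along F (fscale (fun _ => -1) W) by exact: alongZ.
apply/eqP; rewrite -subr_eq0 -mulN1r -(TZ (fun _ => -1) W sN1 aW) -TD //.
apply/eqP/(tensorial0 tT); first exact: alongD.
by rewrite -[LHS]/(V x + -1 *: W x) VW scaleN1r subrr.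
Qed.

(** By tensoriality [V] may be replaced by the restriction of an ambient field
    with the same value at [x]. *)
Lemma tensorial_restriction x T V : tensorial_at x T ->
  (forall Y, vfield Y -> T (Y \o F) = 0) -> vfield_along F V -> T V = 0.
Proof.
move=> tT T0 aV; have [Y vY YV] := tangent_extend (proj1 aV x).
rewrite (tensorial_eq tT aV (along_comp sF vY) _) ?T0 //.
Qed.

Section Tensors.
Variables (phi : N -> tvec R N -> tvec R N) (g : N -> tvec R N -> tvec R N -> R).
Hypothesis tphi : tensor11 phi.
Hypothesis rg : riemannian_metric g.

(** On a multiple of the expansion along global fields, [phi] acts through its
    values on these fields. *)
Lemma tensor11_along V : vfield_along F V ->
  vfield_along F (fun x => phi (F x) (V x)).
Proof.
move=> aV; have [tphi1 _ vphi] := tphi; split=> [x|h sh].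
  by apply: tphi1; case: aV.
apply: smooth_quotient => x; have [f [E [sf fp vE expand]]] := along_expand sF (F x).
have [c [sc VE _]] := expand _ aV.
exists (f \o F), (fun y => \sum_i c i y * phi (F y) (E i (F y)) h); split=> //.
- exact: (smooth_comp sF).
- apply: smooth_sum => i; apply: smoothM => //.
  exact: (smooth_comp sF (proj2 (vphi _ (vE i)) h sh)).
- move=> y; have := congr1 (fun U => U y) VE; rewrite sum_apply /fscale /= => VEy.
  have := congr1 (fun u => phi (F y) u h) VEy.
  rewrite (tensor11Z tphi); last by case: aV.
  rewrite (tensor11_sum tphi); last by move=> i; case: (vE i).
  by rewrite sum_apply.
Qed.

Lemma metric_along V W : vfield_along F V -> vfield_along F W ->
  smooth (fun x => g (F x) (V x) (W x)).
Proof.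
move=> aV aW; case: (rg) => _ _ _ sg; apply: smooth_quotient => x.
have [f [E [sf fp vE expand]]] := along_expand sF (F x).
have [c [sc VE _]] := expand _ aV; have [d [sd WE _]] := expand _ aW.
(* Multiply by f twice, once for each argument. *)
have sfF := smooth_comp sF sf.
exists (fun y => f (F y) * f (F y)),
  (fun y => \sum_i c i y * \sum_j d j y * g (F y) (E i (F y)) (E j (F y))).
split=> //; [exact: smoothM| |by rewrite mulf_neq0|].
  apply: smooth_sum => i; apply: smoothM => //.
  apply: smooth_sum => j; apply: smoothM => //.
  exact: (smooth_comp sF (sg _ _ (vE i) (vE j))).
move=> y; have tV : tangent (F y) (V y) by case: aV.
have tW : tangent (F y) (W y) by case: aW.
have tE i : tangent (F y) (E i (F y)) by case: (vE i).
have := congr1 (fun U => U y) VE; rewrite sum_apply /fscale /= => VEy.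
have := congr1 (fun U => U y) WE; rewrite sum_apply /fscale /= => WEy.
rewrite -mulrA -(metricZr rg _ tW tV) WEy -(metricZl rg) // ?VEy; last exact: tangent_sum.
rewrite (metric_suml rg) //; last exact: tangent_sum.
by apply: eq_bigr => i _; rewrite metric_sumr.
Qed.

End Tensors.

End Tensoriality.

(** * Gram determinants and distributions *)

Section Gram.
Variables (R : realType) (n : nat) (M : manifold R n).
Variable gam : M -> tvec R M -> tvec R M -> R.
Hypothesis rg : riemannian_metric gam.
Variables (k : nat) (E : 'I_k -> M -> tvec R M).
Hypothesis vE : forall i, vfield (E i).

Definition gram (x : M) : 'M[R]_k := \matrix_(i, j) gam x (E i x) (E j x).

Definition gram_row (x : M) (u : tvec R M) : 'rV[R]_k := \row_j gam x u (E j x).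

Definition free_at (x : M) : Prop :=
  forall a : 'rV[R]_k, \sum_i a 0 i *: E i x = 0 -> a = 0.

Lemma frame_tangent x i : tangent x (E i x).
Proof. by case: (vE i) => tE _; exact: tE. Qed.

Lemma gram_row_sum x (a : 'rV[R]_k) : gram_row x (\sum_i a 0 i *: E i x) = a *m gram x.
Proof.
apply/rowP => j; rewrite !mxE (metric_suml rg) //; try exact: frame_tangent.
by apply: eq_bigr => i _; rewrite mxE.
Qed.

(** A row vector in the kernel of the Gram matrix gives a combination of the
    fields that has norm zero. *)
Lemma det_gram_neq0 x : free_at x -> \det (gram x) != 0.
Proof.
move=> fE; apply/negP => /det0P[a a0 aG]; move/negP: a0; apply; apply/eqP/fE.
set u := \sum_i _; have tu : tangent x u.
  by apply: tangent_sum => i; exact: frame_tangent.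
apply: (metric_eq0 rg tu); rewrite {2}/u (metric_sumr rg) //; last first.
  by move=> i; exact: frame_tangent.
have H : gram_row x u = 0 by rewrite gram_row_sum.
apply: big1 => i _; have /rowP/(_ i) := H; rewrite !mxE => ->.
by rewrite mulr0.
Qed.

Lemma smooth_gram i j : smooth (fun x => gram x i j).
Proof.
rewrite (_ : (fun x => _) = fun x => gam x (E i x) (E j x)).
  by case: rg => _ _ _ sg; exact: sg.
by apply/funext => x; rewrite mxE.
Qed.

Lemma smooth_det (l : nat) (A : M -> 'M[R]_l) :
  (forall i j, smooth (fun x => A x i j)) -> smooth (fun x => \det (A x)).
Proof.
move=> sA; rewrite /determinant; apply: smooth_sum => s.
apply: smoothM; first exact: smooth_cst.
by apply: smooth_prod => i.
Qed.

Lemma smooth_adj (l : nat) (A : M -> 'M[R]_l) i j :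
  (forall i j, smooth (fun x => A x i j)) -> smooth (fun x => (\adj (A x)) i j).
Proof.
move=> sA; rewrite (_ : (fun x => _) = fun x => cofactor (A x) j i); last first.
  by apply/funext => x; rewrite mxE.
rewrite /cofactor; apply: smoothM; first exact: smooth_cst.
apply: smooth_det => a b.
rewrite (_ : (fun x => _) = fun x => A x (lift j a) (lift i b)) //.
by apply/funext => x; rewrite !mxE.
Qed.

(** By Cramer's rule, these are the coefficients of the Gram determinant times
    the orthogonal projection of [u] on the span of the fields.  They are
    polynomial in the metric, hence smooth. *)
Definition gram_coef (x : M) (u : tvec R M) : 'rV[R]_k := gram_row x u *m \adj (gram x).

Lemma gram_coefP x u : tangent x u ->
  forall j, gam x (\det (gram x) *: u - \sum_i gram_coef x u 0 i *: E i x) (E j x) = 0.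
Proof.
move=> tu j; have tE := frame_tangent x.
have := gram_row_sum x (gram_coef x u).
rewrite /gram_coef -mulmxA mul_adj_mx mul_mx_scalar => /rowP/(_ j).
rewrite !mxE => H.
rewrite (metricBl rg) //; [|exact: tangentZ|exact: tangent_sum].
by rewrite H (metricZl rg) // subrr.
Qed.

Lemma gram_coef_span x (a : 'rV[R]_k) :
  gram_coef x (\sum_i a 0 i *: E i x) = \det (gram x) *: a.
Proof. by rewrite /gram_coef gram_row_sum -mulmxA mul_mx_adj mul_mx_scalar. Qed.

Lemma smooth_gram_coef (W : M -> tvec R M) i :
  (forall Y, vfield Y -> smooth (fun x => gam x (W x) (Y x))) ->
  smooth (fun x => gram_coef x (W x) 0 i).
Proof.
move=> sW; rewrite (_ : (fun x => _) =
    fun x => \sum_j gam x (W x) (E j x) * (\adj (gram x)) j i).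
  apply: smooth_sum => j; apply: smoothM; first exact: sW.
  by apply: smooth_adj => a b; exact: smooth_gram.
by apply/funext => x; rewrite mxE; apply: eq_bigr => j _; rewrite mxE.
Qed.

End Gram.

Section Distribution.
Variables (R : realType) (n : nat) (M : manifold R n).
Variable gam : M -> tvec R M -> tvec R M -> R.
Hypothesis rg : riemannian_metric gam.
Variable D : M -> set (tvec R M).
Hypothesis sD : smooth_distribution D.
Hypothesis D_neq0 : forall x, exists v, D x v.

(** Uniqueness of coefficients is available only for vectors of [D]; as [D] is
    inhabited, adding a relation to the coefficients of such a vector shows
    that the frame is free. *)
Lemma distribution_frame (x : M) : exists k (E : 'I_k -> M -> tvec R M) (U : set M),
  [/\ nbhs x U, forall i, vfield (E i), forall y, U y -> free_at E y &
      forall y, U y -> forall v, D y v <-> exists a : 'rV[R]_k, v = \sum_i a 0 i *: E i y].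
Proof.
have [k [E [vE nE]]] := sD x.
exists k, E, [set y | forall v, D y v <-> exists! a : 'rV[R]_k, v = \sum_i a 0 i *: E i y].
have fE y : (forall v, D y v <-> exists! a : 'rV[R]_k, v = \sum_i a 0 i *: E i y) ->
    free_at E y.
  move=> Dy a a0; have [v Dv] := D_neq0 y.
  have [b [vb bu]] := (Dy v).1 Dv.
  (* Uniqueness of the coefficients of v forces the relation a to vanish. *)
  have ba : v = \sum_i (b + a) 0 i *: E i y.
    under eq_bigr do rewrite mxE scalerDl.
    by rewrite big_split /= a0 addr0.
  by apply: (@addrI _ b); rewrite addr0; exact: esym (bu _ ba).
split=> // y /= Dy v; split; first by move=> /Dy [a [va _]]; exists a.
move=> [a va]; apply/Dy; exists a; split=> // b vb.
apply/eqP; rewrite -subr_eq0; apply/eqP/(fE y Dy).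
under eq_bigr do rewrite !mxE scalerBl.
by rewrite sumrB -va -vb subrr.
Qed.

Lemma distribution_lin x a u v : D x u -> D x v -> D x (a *: u + v).
Proof.
have [k [E [U [nU vE _ DE]]]] := distribution_frame x.
move=> /(DE x (nbhs_singleton nU)) [b ->] /(DE x (nbhs_singleton nU)) [c ->].
apply/(DE x (nbhs_singleton nU)); exists (a *: b + c).
rewrite scaler_sumr -big_split; apply: eq_bigr => i _.
by rewrite !mxE scalerDl scalerA.
Qed.

Lemma distribution0 x : D x 0.
Proof.
have [k [E [U [nU vE _ DE]]]] := distribution_frame x.
apply/(DE x (nbhs_singleton nU)); exists 0.
by rewrite big1 // => i _; rewrite mxE scale0r.
Qed.

Lemma distributionZ x a u : D x u -> D x (a *: u).
Proof. by move=> Du; rewrite -[_ *: _]addr0; apply: distribution_lin Du (distribution0 x). Qed.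

Lemma distributionD x u v : D x u -> D x v -> D x (u + v).
Proof. by move=> Du; rewrite -[u in u + v]scale1r; exact: distribution_lin. Qed.

Lemma distribution_tangent x v : D x v -> tangent x v.
Proof.
have [k [E [U [nU vE _ DE]]]] := distribution_frame x.
move=> /(DE x (nbhs_singleton nU)) [b ->].
by apply: tangent_sum => i; exact: frame_tangent.
Qed.

Lemma section_extend x v : D x v -> exists2 Y, section D Y & Y x = v.
Proof.
have [k [E [U [nU vE _ DE]]]] := distribution_frame x.
move=> /(DE x (nbhs_singleton nU)) [a va]; have [b [sb bx bU]] := smooth_bump nU.
exists (fscale (fun y => (b x)^-1 * b y) (\sum_i fscale (fun _ => a 0 i) (E i))).
  split.
    apply: vfieldZ; first by apply: smoothM => //; exact: smooth_cst.
    by apply: vfield_sum => i; apply: vfieldZ => //; exact: smooth_cst.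
  move=> y; rewrite /fscale; have [Uy|nUy] := pselect (U y).
    by apply: distributionZ; apply/(DE y Uy); exists a; rewrite sum_apply.
  by rewrite (bU y nUy) mulr0 scale0r; exact: distribution0.
by rewrite /fscale mulVf // scale1r va sum_apply.
Qed.

(** Extend [e] to any field and subtract its projection on [D], after
    multiplying by the Gram determinant to avoid division; a bump function
    makes the local formula global. *)
Lemma orthocompl_extend x e : orthocompl gam D x e ->
  exists2 Z, section (orthocompl gam D) Z & Z x = e.
Proof.
move=> [te pe]; have [k [E [U [nU vE fE DE]]]] := distribution_frame x.
have [b [sb bx bU]] := smooth_bump nU; have Ux := nbhs_singleton nU.
have [W vW Wx] := tangent_extend te.
have dx := det_gram_neq0 rg vE (fE x Ux).
(* The Gram determinant times the component of W orthogonal to D. *)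
pose P : M -> tvec R M := fscale (fun y => \det (gram gam E y)) W +
   fscale (fun _ => -1) (\sum_i fscale (fun y => gram_coef gam E y (W y) 0 i) (E i)).
have PE y : P y = \det (gram gam E y) *: W y - \sum_i gram_coef gam E y (W y) 0 i *: E i y.
  by rewrite -scaleN1r -[LHS]/(_ + _ *: _) sum_apply.
have vP : vfield P.
  apply: vfieldD.
    by apply: vfieldZ => //; apply: smooth_det => i j; exact: smooth_gram.
  apply: vfieldZ; first exact: smooth_cst.
  apply: vfield_sum => i; apply: vfieldZ => //; apply: smooth_gram_coef => // Y vY.
  by case: rg => _ _ _; apply.
have tE y i : tangent y (E i y) by exact: frame_tangent.
exists (fscale (fun y => (b x * \det (gram gam E x))^-1 * b y) P).
  split.
    by apply: vfieldZ => //; apply: smoothM => //; exact: smooth_cst.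
  move=> y; split; first by apply: tangentZ; case: vP => tP _; exact: tP.
  move=> w Dw; have tw := distribution_tangent Dw; rewrite /fscale.
  have [Uy|nUy] := pselect (U y); last by rewrite (bU y nUy) mulr0 scale0r (metric0l rg).
  have [a wa] := (DE y Uy w).1 Dw.
  have tP : tangent y (P y) by case: vP => tP _; exact: tP.
  have tWy : tangent y (W y) by case: vW => tW _; exact: tW.
  rewrite (metricZl rg _ tP tw) wa (metric_sumr rg _ _ (tE y) tP).
  rewrite big1 ?mulr0 // => i _.
  by rewrite PE (gram_coefP rg vE tWy) mulr0.
have c0 : gram_coef gam E x (W x) = 0.
  rewrite /gram_coef (_ : gram_row _ _ _ _ = 0) ?mul0mx //.
  apply/rowP => j; rewrite !mxE Wx; apply: pe; apply/(DE x Ux).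
  exists (delta_mx 0 j); rewrite (bigD1 j) //= mxE !eqxx scale1r big1 ?addr0 //.
  by move=> i /negPf ij; rewrite mxE ij andbF scale0r.
rewrite /fscale PE c0 big1 ?subr0 => [|i _]; last by rewrite mxE scale0r.
by rewrite Wx scalerA -mulrA mulVf ?scale1r // mulf_neq0.
Qed.

(** Cramer's rule in a local frame of [D] recovers the components of [W] from
    its scalar products with vector fields. *)
Lemma section_weak (W : M -> tvec R M) : (forall x, D x (W x)) ->
  (forall Y, vfield Y -> smooth (fun x => gam x (W x) (Y x))) -> section D W.
Proof.
move=> DW sW; split=> //; split=> [x|f sf]; first exact: distribution_tangent.
apply: smooth_quotient => x.
have [k [E [U [nU vE fE DE]]]] := distribution_frame x.
have [b [sb bx bU]] := smooth_bump nU; have Ux := nbhs_singleton nU.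
have dx := det_gram_neq0 rg vE (fE x Ux).
exists (fun y => b y * \det (gram gam E y)),
  (fun y => b y * \sum_i gram_coef gam E y (W y) 0 i * E i y f); split.
- by apply: smoothM => //; apply: smooth_det => i j; exact: smooth_gram.
- apply: smoothM => //; apply: smooth_sum => i; apply: smoothM.
    exact: smooth_gram_coef.
  by case: (vE i) => _; apply.
- by rewrite mulf_neq0.
- move=> y; have [Uy|nUy] := pselect (U y); last by rewrite (bU y nUy) !mul0r.
  have [a ->] := (DE y Uy _).1 (DW y); rewrite gram_coef_span // -mulrA; congr (_ * _).
  rewrite sum_apply mulr_sumr; apply: eq_bigr => i _.
  by rewrite mxE mulrA.
Qed.

End Distribution.

(** * Orthogonal projection onto a submanifold *)

Section Submanifold.
Variables (R : realType) (m n : nat) (N : manifold R m) (M : manifold R n).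
Variables (iota : M -> N) (g : N -> tvec R N -> tvec R N -> R).
Hypothesis im : immersion iota.
Hypothesis rg : riemannian_metric g.

Local Notation gam := (induced_metric iota g).

Let si : smooth_map iota := proj1 im.

Lemma tmap_tangent x v : tangent x v -> tangent (iota x) (tmap iota v).
Proof. exact: tangent_tmap. Qed.

(** Positivity is where the injectivity of the differential of [iota] is used. *)
Lemma induced_riemannian : riemannian_metric gam.
Proof.
split=> [x a u v w tu tv tw|x u v tu tv|x u tu u0|X Y vX vY].
- rewrite /induced_metric tmap_lin; case: rg => gl _ _ _.
  by apply: gl; exact: tmap_tangent.
- by rewrite /induced_metric (metricC rg) //; exact: tmap_tangent.
- case: rg => _ _ gpos _; apply: gpos; first exact: tmap_tangent.
  apply: contra_neq u0; rewrite -(tmap0 iota) => E.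
  exact: (proj2 im) _ _ _ tu (tangent0 x) E.
- by apply: (metric_along si rg); exact: push_along.
Qed.

(** Solve the normal equations in a frame of [M] at [x]; their matrix is the
    Gram matrix of the frame for the induced metric. *)
Lemma tan_part_exists x u : tangent (iota x) u ->
  exists v, tangent x v /\ normal iota g x (u - tmap iota v).
Proof.
move=> tu; have [f [E [psi [[_ fx _] vE span dual]]]] := bump_frame x.
have f3 : f x ^+ 3 != 0 by rewrite expf_neq0.
have fE : free_at E x.
  move=> a a0; apply/rowP => j; rewrite mxE.
  have H h : \sum_i a 0 i * E i x h = 0.
    by rewrite -[RHS](congr1 (fun w : tvec R M => w h) a0) sum_apply.
  have : f x ^+ 3 * a 0 j = 0.
    have <- : f x * \sum_i a 0 i * E i x (psi j) - psi j x * \sum_i a 0 i * E i x f = 0.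
      by rewrite !H !mulr0 subrr.
    rewrite !mulr_sumr -sumrB (bigD1 j) //= big1 ?addr0 => [|i ij].
      have := dual x j j; rewrite eqxx mulr1 => <-; ring.
    have := dual x i j; rewrite (negPf ij) mulr0 => H0.
    have -> : f x * (a 0 i * E i x (psi j)) - psi j x * (a 0 i * E i x f) =
      a 0 i * (f x * E i x (psi j) - psi j x * E i x f) by ring.
    by rewrite H0 mulr0.
  by move/eqP; rewrite mulf_eq0 (negPf f3) => /eqP.
have dG := det_gram_neq0 induced_riemannian vE fE.
have uG : gram gam E x \in unitmx by rewrite unitmxE unitfE.
have tE i : tangent x (E i x) by exact: frame_tangent.
have tiE i : tangent (iota x) (tmap iota (E i x)) by exact: tmap_tangent.
pose w : 'rV[R]_n := \row_j g (iota x) u (tmap iota (E j x)).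
pose b := w *m invmx (gram gam E x).
pose v := \sum_i b 0 i *: E i x.
have tv : tangent x v by exact: tangent_sum.
have tiv := tmap_tangent tv.
exists v; split=> //; split=> [|z tz]; first exact: tangentB.
have zE : z = \sum_i ((f x ^+ 3)^-1 * (f x * z (psi i) - psi i x * z f)) *: E i x.
  apply: (scalerI f3); rewrite (span x z tz) scaler_sumr.
  by apply: eq_bigr => i _; rewrite scalerA mulrA mulfV // mul1r.
rewrite (metricBl rg) //; last exact: tmap_tangent.
have vz := gram_row_sum induced_riemannian vE x b.
have key j : g (iota x) u (tmap iota (E j x)) = gam x v (E j x).
  have -> : gam x v (E j x) = (b *m gram gam E x) 0 j by rewrite -vz mxE.
  have -> : (b *m gram gam E x) 0 j = w 0 j by rewrite /b mulmxKV.
  by rewrite mxE.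
have tmap_sum (c : 'I_n -> R) : tmap iota (\sum_i c i *: E i x) = \sum_i c i *: tmap iota (E i x).
  elim: (index_enum _) => [|i r IH]; first by rewrite !big_nil (tmap0 iota).
  by rewrite !big_cons tmap_lin IH.
rewrite zE tmap_sum !(metric_sumr rg) // -sumrB big1 // => i _.
by rewrite key -mulrBr subrr mulr0.
Qed.

Lemma tan_partP x u : tangent (iota x) u ->
  tangent x (tan_part iota g x u) /\ normal iota g x (nor_part iota g x u).
Proof. by move=> /tan_part_exists ex; exact: (xgetPex 0 ex). Qed.

Lemma tan_part_tangent x u : tangent (iota x) u -> tangent x (tan_part iota g x u).
Proof. by case/tan_partP. Qed.

Lemma tan_part_metric x u v : tangent (iota x) u -> tangent x v ->
  g (iota x) (tmap iota (tan_part iota g x u)) (tmap iota v) = g (iota x) u (tmap iota v).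
Proof.
move=> tu tv; have [tt [_ nu]] := tan_partP tu.
have := nu v tv; rewrite /nor_part (metricBl rg) //; try exact: tmap_tangent.
by move/eqP; rewrite subr_eq0 => /eqP.
Qed.

Lemma tan_part_tmap x v : tangent x v -> tan_part iota g x (tmap iota v) = v.
Proof.
move=> tv; have tt := tan_part_tangent (tmap_tangent tv).
apply: (metric_inj induced_riemannian tt tv) => w tw.
by apply: tan_part_metric => //; exact: tmap_tangent.
Qed.

End Submanifold.

(** * Dual connections and the Sasakian structure *)

Section StatisticalAlgebra.
Variables (R : realType) (n : nat) (N : manifold R n).
Variables (nabla nablas : (N -> tvec R N) -> (N -> tvec R N) -> (N -> tvec R N)).
Variable g : N -> tvec R N -> tvec R N -> R.

Lemma dual_connection_sym : riemannian_metric g -> affine_connection nabla ->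
  dual_connection g nabla nablas -> dual_connection g nablas nabla.
Proof.
move=> rg anabla [anablas dual]; split=> // X Y Z vX vY vZ p.
have [vn _ _ _] := anabla; have [vns _ _ _] := anablas.
have tY : tangent p (Y p) by case: vY => tY _; exact: tY.
have tZ : tangent p (Z p) by case: vZ => tZ _; exact: tZ.
have tn : tangent p (nabla X Z p) by case: (vn _ _ vX vZ) => t _; exact: t.
have tns : tangent p (nablas X Y p) by case: (vns _ _ vX vY) => t _; exact: t.
rewrite (_ : (fun q => _) = fun q => g q (Z q) (Y q)).
  by rewrite dual // addrC (metricC rg tZ tns) (metricC rg tn tY).
apply/funext => q; apply: (metricC rg); first by case: vY => t _; exact: t.
by case: vZ => t _; exact: t.
Qed.

(** The difference [K] of [nabla] and the Levi-Civita connection is symmetric,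
    since both are torsion-free, and Codazzi's equation then makes
    [g (K (X, Y)) Z] totally symmetric.  Duality says that the difference
    of [nablas] and the Levi-Civita connection is minus the adjoint of [K]. *)
Lemma dual_reflection nablah X Z p : statistical_manifold nabla g ->
  dual_connection g nabla nablas -> levi_civita g nablah ->
  vfield X -> vfield Z ->
  nablas X Z p = nablah X Z p - (nabla X Z p - nablah X Z p).
Proof.
move=> [rg an tn cod] [ans dual] [ah th mh] vX vZ.
have [vn _ _ _] := an; have [vns _ _ _] := ans; have [vh _ _ _] := ah.
have tV (V : N -> tvec R N) q : vfield V -> tangent q (V q) by case=> t _; exact: t.
have tnab A B : vfield A -> vfield B -> tangent p (nabla A B p) by move=> a b; apply/tV/vn.
have tnabh A B : vfield A -> vfield B -> tangent p (nablah A B p) by move=> a b; apply/tV/vh.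
have tnabs A B : vfield A -> vfield B -> tangent p (nablas A B p) by move=> a b; apply/tV/vns.
pose K A B := nabla A B p - nablah A B p.
have tK A B : vfield A -> vfield B -> tangent p (K A B).
  by move=> a b; apply: tangentB; [exact: tnab|exact: tnabh].
have Ksym A B : vfield A -> vfield B -> K A B = K B A.
  move=> a b; rewrite /K.
  have e1 : nabla A B p - nabla B A p = bracket A B p by rewrite -(tn A B a b).
  have e2 : nablah A B p - nablah B A p = bracket A B p by rewrite -(th A B a b).
  have e3 : nabla A B p = bracket A B p + nabla B A p by rewrite -e1 subrK.
  have e4 : nablah A B p = bracket A B p + nablah B A p by rewrite -e2 subrK.
  by rewrite e3 e4 opprD addrACA subrr add0r.
pose k A B C := g p (K A B) (C p).
have ksym A B C : vfield A -> vfield B -> k A B C = k B A C.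
  by move=> a b; rewrite /k Ksym.
have kE A B C : vfield A -> vfield B -> vfield C ->
    k A B C = g p (nabla A B p) (C p) - g p (nablah A B p) (C p).
  by move=> a b c; rewrite /k /K (metricBl rg) //; [exact: tnab|exact: tnabh|exact: tV].
have lc A B C : vfield A -> vfield B -> vfield C ->
    A p (fun q => g q (B q) (C q)) = g p (nablah A B p) (C p) + g p (nablah A C p) (B p).
  move=> a b c; have := congr1 (fun F => F p) (mh A B C a b c); rewrite /nabla_metric.
  rewrite (metricC rg (tV _ p b) (tnabh _ _ a c)); lra.
have nm A B C : vfield A -> vfield B -> vfield C ->
    nabla_metric nabla g A B C p = - k A B C - k A C B.
  move=> a b c; rewrite /nabla_metric lc // !kE //.
  rewrite (metricC rg (tV _ p b) (tnab _ _ a c)); lra.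
(* Codazzi's equation exchanges the outer arguments; together with ksym this
   generates all the permutations. *)
have kswap A B C : vfield A -> vfield B -> vfield C -> k A B C = k C B A.
  move=> a b c; have := congr1 (fun F => F p) (cod A C B a c b).
  rewrite /= !nm // (ksym C A B) //; lra.
apply: (metric_inj rg); [exact: tnabs| |move=> w tw].
  by apply: tangentB; [exact: tnabh|exact: tK].
have [Y vY <-] := tangent_extend tw.
have tY := tV _ p vY.
rewrite (metricBl rg) //; [|exact: tnabh|exact: tK].
have d := dual X Y Z vX vY vZ p.
rewrite (lc _ _ _ vX vY vZ) (metricC rg tY (tnabs _ _ vX vZ)) in d.
have e : k X Y Z = k X Z Y by rewrite (ksym X Y Z) // (kswap Y X Z) // (ksym Z X Y).
rewrite -/(K X Z) -/(k X Z Y) -e kE //; lra.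
Qed.

End StatisticalAlgebra.

Lemma cancel_sum (U : zmodType) (a1 a2 b1 b2 : U) : a1 - a2 + (b1 - b2) = 0 ->
  a1 - (b2 - (b1 - b2)) = a2 - b2 /\ a2 - (a1 - a2) - b1 = a2 - b2.
Proof.
move=> /eqP; rewrite addr_eq0 subr_eq => /eqP ->; split.
  by rewrite [- (b2 - _)]opprB addrACA addNr add0r.
by rewrite addrK opprK -addrA addrAC subrr sub0r.
Qed.

Section Sasakian.
Variables (R : realType) (n : nat) (N : manifold R n).
Variables (nabla nablas : (N -> tvec R N) -> (N -> tvec R N) -> (N -> tvec R N)).
Variable g : N -> tvec R N -> tvec R N -> R.
Variables (phi : N -> tvec R N -> tvec R N) (xi : N -> tvec R N) (eta : N -> tvec R N -> R).
Hypothesis sas : sasakian_statistical nabla g phi xi eta.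
Hypothesis dual : dual_connection g nabla nablas.

Lemma sasakian_metric : riemannian_metric g.
Proof. by case: sas => -[]. Qed.

Lemma sasakian_tensor : tensor11 phi.
Proof. by case: sas => _ [[]]. Qed.

Lemma dual_torsion_free : torsion_free nablas.
Proof.
have [stat _ [nablah [lc _ _ _]]] := sas => X Y vX vY; apply/funext => p.
have [_ _ tn _] := stat; have [_ th _] := lc.
have E A B := @dual_reflection _ _ _ _ _ _ nablah A B p stat dual lc.
rewrite -[LHS]/(nablas X Y p - nablas Y X p) !E //.
have e1 : nabla X Y p = bracket X Y p + nabla Y X p.
  by rewrite -(tn X Y vX vY) -[(_ - _) p]/(nabla X Y p - nabla Y X p) subrK.
have e2 : nablah X Y p = bracket X Y p + nablah Y X p.
  by rewrite -(th X Y vX vY) -[(_ - _) p]/(nablah X Y p - nablah Y X p) subrK.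
rewrite e1 e2; apply/funext => f; rewrite !fctE; ring.
Qed.

(** The Levi-Civita connection contributes the right-hand side.  What remains
    is, up to sign, [K (X, phi Y) + phi (K (X, Y))], which is zero for a
    Sasakian statistical structure. *)
Lemma sasakian_phi X Y p : vfield X -> vfield Y ->
  nabla X (fun q => phi q (Y q)) p - phi p (nablas X Y p) =
    g p (Y p) (xi p) *: X p - g p (Y p) (X p) *: xi p /\
  nablas X (fun q => phi q (Y q)) p - phi p (nabla X Y p) =
    g p (Y p) (xi p) *: X p - g p (Y p) (X p) *: xi p.
Proof.
have [stat _ [nablah [lc _ hphi Kphi]]] := sas => vX vY.
have [_ _ vphi] := sasakian_tensor.
have vpY := vphi Y vY; have [rg [vn _ _ _] _ _] := stat; have [[vh _ _ _] _ _] := lc.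
have tV (V : N -> tvec R N) q : vfield V -> tangent q (V q) by case=> t _; exact: t.
have tn := tV _ p (vn _ _ vX vY); have th := tV _ p (vh _ _ vX vY).
have E A B := @dual_reflection _ _ _ _ _ _ nablah A B p stat dual lc.
have h1 := hphi X Y vX vY p; have h2 := Kphi X Y vX vY p.
rewrite !E // !(tensor11B sasakian_tensor) //; try exact: tangentB.
rewrite -h1; move: h2 => /=.
rewrite -[(nabla X _ - nablah X _) p]/(nabla X (fun q => phi q (Y q)) p
    - nablah X (fun q => phi q (Y q)) p).
rewrite -[(nabla X Y - nablah X Y) p]/(nabla X Y p - nablah X Y p).
rewrite (tensor11B sasakian_tensor) // => h2.
exact: cancel_sum h2.
Qed.

(** Apply the compatibility of [g] and [phi] to [u] and [phi v]; this needs
    [eta (phi w) = 0], which follows by comparing the two ways to compute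
    [phi (phi (phi w))]. *)
Lemma sasakian_skew p u v : tangent p u -> tangent p v ->
  g p (phi p u) v = - g p u (phi p v).
Proof.
have rg := sasakian_metric; have tphi := sasakian_tensor.
have [_ [[_ vxi _] xi1 phi2 geta gphi] _] := sas => tu tv.
have tp w : tangent p w -> tangent p (phi p w) by case: tphi => + _ _; apply.
have txi : tangent p (xi p) by case: vxi => t _; exact: t.
have eta_phi w : tangent p w -> eta p (phi p w) = 0.
  move=> tw; have tpw := tp _ tw.
  have etaxi : eta p (xi p) = 1 by rewrite -geta.
  have phixi : phi p (xi p) = 0.
    by apply: (metric_eq0 rg (tp _ txi)); rewrite gphi // xi1 etaxi mulr1 subrr.
  have e1 : phi p (phi p (phi p w)) = - phi p w.
    rewrite [phi p (phi p w)]phi2 // (tensor11D tphi) ?(tensor11N tphi) ?(tensor11Z tphi) //.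
    + by rewrite phixi scaler0 addr0.
    + exact: tangentN.
    + exact: tangentZ.
  (* The same vector, computed from the square of phi at phi w. *)
  have e2 : eta p (phi p w) *: xi p = 0.
    by apply: (addrI (- phi p w)); rewrite addr0 -{2}e1 phi2 //.
  by have := metric0l rg txi; rewrite -e2 (metricZl rg) // xi1 mulr1.
have := gphi p u (phi p v) tu (tp _ tv).
rewrite phi2 // eta_phi // mulr0 subr0 (metricDr rg) //; [|exact: tangentN|exact: tangentZ|exact: tp].
rewrite (metricNr rg) // ?(metricZr rg) // ?geta ?eta_phi ?mulr0 ?addr0 //; try exact: tp.
by move=> <-; rewrite opprK.
Qed.

End Sasakian.

(** * Induced connections *)

Section InducedConnection.
Variables (R : realType) (m n : nat) (N : manifold R m) (M : manifold R n).
Variables (iota : M -> N) (g : N -> tvec R N -> tvec R N -> R).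
Hypothesis im : immersion iota.
Hypothesis rg : riemannian_metric g.
Implicit Types (X Y : M -> tvec R M) (V W : M -> tvec R N).

Let si : smooth_map iota := proj1 im.

Lemma along_tangent V x : vfield_along iota V -> tangent (iota x) (V x).
Proof. by case=> tV _; exact: tV. Qed.

Lemma vfield_tangent X x : vfield X -> tangent x (X x).
Proof. by case=> tX _; exact: tX. Qed.

Section OneConnection.
Variables (nabla : (N -> tvec R N) -> (N -> tvec R N) -> (N -> tvec R N)).
Variables (nb : (M -> tvec R M) -> (M -> tvec R N) -> (M -> tvec R N)).
Hypothesis ind : induced_connection iota nabla nb.

Lemma induced_along X V : vfield X -> vfield_along iota V -> vfield_along iota (nb X V).
Proof. by case: ind => i1 _ _ _ _; exact: i1. Qed.

Lemma induced_tangent X V x : vfield X -> vfield_along iota V -> tangent (iota x) (nb X V x).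
Proof. by move=> vX aV; apply: along_tangent; exact: induced_along. Qed.

Lemma inducedD X V W x : vfield X -> vfield_along iota V -> vfield_along iota W ->
  nb X (V + W) x = nb X V x + nb X W x.
Proof. by case: ind => _ _ i3 _ _ vX aV aW; rewrite i3. Qed.

Lemma inducedZ f X V x : smooth f -> vfield X -> vfield_along iota V ->
  nb X (fscale f V) x = X x f *: V x + f x *: nb X V x.
Proof. by case: ind => _ _ _ i4 _ sf vX aV; rewrite i4. Qed.

(** This functional is minus the Hessian of [psi] along [iota]: the derivatives
    of the coefficients of [V] cancel. *)
Lemma tensorial_torsion X psi x : vfield X -> smooth psi ->
  tensorial_at iota x (fun V => nb X V x psi - X x (fun y => V y psi)).
Proof.
move=> vX spsi; have tX := vfield_tangent x vX; split.
  move=> V W aV aW; rewrite inducedD // -[(_ + _) psi]/(nb X V x psi + nb X W x psi).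
  have := tangent_derivD tX (proj2 aV psi spsi) (proj2 aW psi spsi).
  rewrite -[X x (fun y => (V + W) y psi)]/(X x (fun y => V y psi + W y psi)) => ->.
  ring.
move=> f V sf aV; rewrite inducedZ //.
rewrite -[(_ + _) psi]/(X x f * V x psi + f x * nb X V x psi).
have := tangent_derivM tX sf (proj2 aV psi spsi).
rewrite -[X x (fun y => fscale f V y psi)]/(X x (fun y => f y * V y psi)) => ->.
ring.
Qed.

(** By tensoriality the Hessian of [psi] at [(X, Y)] is computed by extending both
    fields to [N], where it is symmetric because [nabla] is torsion-free;
    exchanging [X] and [Y] leaves only the bracket. *)
Lemma induced_torsion_free X Y x : torsion_free nabla -> vfield X -> vfield Y ->
  vfield (bracket X Y) ->
  nb X (push iota Y) x - nb Y (push iota X) x = tmap iota (bracket X Y x).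
Proof.
move=> tf vX vY vXY; have aX := push_along si vX; have aY := push_along si vY.
have tl : tangent (iota x) (nb X (push iota Y) x - nb Y (push iota X) x).
  by apply: tangentB; exact: induced_tangent.
apply/funext => psi; have [spsi|nspsi] := pselect (smooth psi); last first.
  have tr := tangent_tmap si (vfield_tangent x vXY).
  by rewrite (tangent_nonsmooth tl nspsi) (tangent_nonsmooth tr nspsi).
have [X' vX' X'x] := tangent_extend (along_tangent x aX).
have [Y' vY' Y'x] := tangent_extend (along_tangent x aY).
have [_ _ _ _ i5] := ind.
have hess A B A' B' : vfield A -> vfield B -> vfield A' -> vfield B' ->
    A' (iota x) = push iota A x -> B' (iota x) = push iota B x ->
    nb A (push iota B) x psi - A x (fun y => push iota B y psi) =
    nabla A' B' (iota x) psi - A' (iota x) (fun q => B' q psi).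
  move=> vA vB vA' vB' EA EB.
  have := tensorial_eq si (tensorial_torsion x vA spsi) (push_along si vB)
    (along_comp si vB') (esym EB) => ->.
  rewrite (i5 A A' B' x vA vA' vB' EA) EA /push tmapE //.
  by case: vB' => _; apply.
have hXY := hess _ _ _ _ vX vY vX' vY' X'x Y'x.
have hYX := hess _ _ _ _ vY vX vY' vX' Y'x X'x.
have tfp := congr1 (fun F : N -> tvec R N => F (iota x) psi) (tf X' Y' vX' vY').
have {}tfp : nabla X' Y' (iota x) psi - nabla Y' X' (iota x) psi =
  X' (iota x) (fun q => Y' q psi) - Y' (iota x) (fun q => X' q psi) by exact: tfp.
rewrite tmapE // /bracket.
have pE A : (fun y => push iota A y psi) = fun y => A y (psi \o iota).
  by apply/funext => y; rewrite /push tmapE.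
rewrite !pE in hXY hYX.
rewrite -[LHS]/(nb X (push iota Y) x psi - nb Y (push iota X) x psi); lra.
Qed.

End OneConnection.

(** The defect of the identity is tensorial in [V] and in [W], and it is zero
    on restrictions of ambient fields. *)
Lemma induced_duality nabla nablas nb nbs X V W x :
  dual_connection g nabla nablas ->
  induced_connection iota nabla nb -> induced_connection iota nablas nbs ->
  vfield X -> vfield_along iota V -> vfield_along iota W ->
  X x (fun y => g (iota y) (V y) (W y)) =
  g (iota x) (nb X V x) (W x) + g (iota x) (V x) (nbs X W x).
Proof.
move=> [_ dual] ind inds vX aV aW.
have tX := vfield_tangent x vX.
have tA U y : vfield_along iota U -> tangent (iota y) (U y) by move=> aU; exact: along_tangent.
have tn := induced_tangent ind x vX; have tns := induced_tangent inds x vX.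
have sm U U' := @metric_along _ _ _ _ _ _ si _ rg U U'.
pose T U U' := X x (fun y => g (iota y) (U y) (U' y)) -
  g (iota x) (nb X U x) (U' x) - g (iota x) (U x) (nbs X U' x).
have TD1 U U' U2 : vfield_along iota U -> vfield_along iota U' -> vfield_along iota U2 ->
    T (U + U') U2 = T U U2 + T U' U2.
  move=> a a' a2; rewrite /T.
  have -> : (fun y => g (iota y) ((U + U') y) (U2 y)) =
      fun y => g (iota y) (U y) (U2 y) + g (iota y) (U' y) (U2 y).
    by apply/funext => y; apply: (metricDl rg); exact: tA.
  rewrite (tangent_derivD tX (sm _ _ a a2) (sm _ _ a' a2)) (inducedD ind) //.
  rewrite (metricDl rg) //; [|exact: tn|exact: tn|exact: tA].
  rewrite -[(U + U') x]/(U x + U' x) (metricDl rg); [|exact: tA|exact: tA|exact: tns].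
  ring.
have TD2 U U' U2 : vfield_along iota U -> vfield_along iota U' -> vfield_along iota U2 ->
    T U2 (U + U') = T U2 U + T U2 U'.
  move=> a a' a2; rewrite /T.
  have -> : (fun y => g (iota y) (U2 y) ((U + U') y)) =
      fun y => g (iota y) (U2 y) (U y) + g (iota y) (U2 y) (U' y).
    by apply/funext => y; apply: (metricDr rg); exact: tA.
  rewrite (tangent_derivD tX (sm _ _ a2 a) (sm _ _ a2 a')) (inducedD inds) //.
  rewrite (metricDr rg) //; [|exact: tns|exact: tns|exact: tA].
  rewrite -[(U + U') x]/(U x + U' x) (metricDr rg); [|exact: tA|exact: tA|exact: tn].
  ring.
have TZ1 f U U2 : smooth f -> vfield_along iota U -> vfield_along iota U2 ->
    T (fscale f U) U2 = f x * T U U2.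
  move=> sf a a2; rewrite /T.
  have -> : (fun y => g (iota y) (fscale f U y) (U2 y)) =
      fun y => f y * g (iota y) (U y) (U2 y).
    by apply/funext => y; apply: (metricZl rg); exact: tA.
  rewrite (tangent_derivM tX sf (sm _ _ a a2)) (inducedZ ind) //.
  rewrite (metricDl rg); [|exact/tangentZ/tA|exact/tangentZ/tn|exact: tA].
  rewrite !(metricZl rg); try exact: tA; try exact: tn; try exact: tns.
  ring.
have TZ2 f U U2 : smooth f -> vfield_along iota U -> vfield_along iota U2 ->
    T U2 (fscale f U) = f x * T U2 U.
  move=> sf a a2; rewrite /T.
  have -> : (fun y => g (iota y) (U2 y) (fscale f U y)) =
      fun y => f y * g (iota y) (U2 y) (U y).
    by apply/funext => y; apply: (metricZr rg); exact: tA.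
  rewrite (tangent_derivM tX sf (sm _ _ a2 a)) (inducedZ inds) //.
  rewrite (metricDr rg); [|exact/tangentZ/tA|exact/tangentZ/tns|exact: tA].
  rewrite !(metricZr rg); try exact: tA; try exact: tn; try exact: tns.
  ring.
suff : T V W = 0 by rewrite /T; lra.
apply: (@tensorial_restriction _ _ _ _ _ _ si x (T^~ W)) => // [|Y vY].
  by split=> [U U' a a'|f U sf a]; [exact: TD1|exact: TZ1].
have aY := along_comp si vY.
apply: (@tensorial_restriction _ _ _ _ _ _ si x (T (Y \o iota))) => // [|Z vZ].
  by split=> [U U' a a'|f U sf a]; [exact: TD2|exact: TZ2].
have [X' vX' X'x] := tangent_extend (tangent_tmap si tX).
have [_ _ _ _ i5] := ind; have [_ _ _ _ i5s] := inds.
rewrite /T /= (i5 X X' Y x) // (i5s X X' Z x) //.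
have := dual X' Y Z vX' vY vZ (iota x); rewrite X'x tmapE; last by case: rg => _ _ _; apply.
rewrite -[X x (_ \o _)]/(X x (fun y => g (iota y) (Y (iota y)) (Z (iota y)))); lra.
Qed.

(** Both sides are tensorial in [V]: the derivatives of a coefficient contribute
    the same multiple of [phi V] to the two terms on the left. *)
Lemma induced_phi nabla nablas nb nbs (phi : N -> tvec R N -> tvec R N)
    (xi : N -> tvec R N) X V x : tensor11 phi -> vfield xi ->
  (forall (A B : N -> tvec R N) p, vfield A -> vfield B ->
     nabla A (fun q => phi q (B q)) p - phi p (nablas A B p) =
     g p (B p) (xi p) *: A p - g p (B p) (A p) *: xi p) ->
  induced_connection iota nabla nb -> induced_connection iota nablas nbs ->
  vfield X -> vfield_along iota V ->
  nb X (fun y => phi (iota y) (V y)) x - phi (iota x) (nbs X V x) =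
  g (iota x) (V x) (xi (iota x)) *: push iota X x
    - g (iota x) (V x) (push iota X x) *: xi (iota x).
Proof.
move=> tphi vxi hphi ind inds vX aV; have [_ _ vphi] := tphi.
have tX := vfield_tangent x vX; have tpX := tangent_tmap si tX.
have txi : tangent (iota x) (xi (iota x)) by case: vxi => t _; exact: t.
have tA U y : vfield_along iota U -> tangent (iota y) (U y) by move=> aU; exact: along_tangent.
have tns := induced_tangent inds x vX.
have aphi U := @tensor11_along _ _ _ _ _ _ si _ tphi U.
pose Q U := nb X (fun y => phi (iota y) (U y)) x - phi (iota x) (nbs X U x)
  - (g (iota x) (U x) (xi (iota x)) *: push iota X x
    - g (iota x) (U x) (push iota X x) *: xi (iota x)).
suff Q0 : Q V = 0 by apply/eqP; rewrite -subr_eq0; apply/eqP; exact: Q0.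
apply/funext => psi.
apply: (@tensorial_restriction _ _ _ _ _ _ si x (fun U => Q U psi)) => // [|Y vY].
  split=> [U U' a a'|f U sf a].
    rewrite -[RHS]/((Q U + Q U') psi); congr (_ psi); rewrite /Q.
    have -> : (fun y => phi (iota y) ((U + U') y)) =
      (fun y => phi (iota y) (U y)) + (fun y => phi (iota y) (U' y)).
      by apply/funext => y; apply: (tensor11D tphi); exact: tA.
    rewrite (inducedD ind x vX (aphi _ a) (aphi _ a')) (inducedD inds x vX a a').
    rewrite (tensor11D tphi); [|exact: tns|exact: tns].
    rewrite -[(U + U') x]/(U x + U' x) !(metricDl rg) //; try exact: tA.
    by rewrite !scalerDl; apply/funext => h; rewrite !fctE; ring.
  rewrite -[RHS]/((f x *: Q U) psi); congr (_ psi); rewrite /Q.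
  have -> : (fun y => phi (iota y) (fscale f U y)) = fscale f (fun y => phi (iota y) (U y)).
    by apply/funext => y; apply: (tensor11Z tphi); exact: tA.
  rewrite (inducedZ ind x sf vX (aphi _ a)) (inducedZ inds x sf vX a).
  rewrite (tensor11D tphi); [|exact/tangentZ/tA|exact/tangentZ/tns].
  rewrite !(tensor11Z tphi); [|exact: tns|exact: tA].
  rewrite /fscale !(metricZl rg) //; try exact: tA.
  by apply/funext => h; rewrite !fctE /GRing.scale /=; ring.
have [X' vX' X'x] := tangent_extend tpX.
have [_ _ _ _ i5] := ind; have [_ _ _ _ i5s] := inds.
rewrite /Q.
have -> : nb X (fun y => phi (iota y) ((Y \o iota) y)) x =
    nabla X' (fun q => phi q (Y q)) (iota x).
  exact: (i5 X X' (fun q => phi q (Y q)) x vX vX' (vphi _ vY) X'x).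
rewrite (i5s X X' Y x) // hphi // X'x.
by rewrite subrr.
Qed.

End InducedConnection.

(** * Contact CR-submanifolds *)

Section ContactCR.
Variables (R : realType) (m n : nat) (N : manifold R m) (M : manifold R n).
Variables (iota : M -> N) (g : N -> tvec R N -> tvec R N -> R).
Variables (nabla nablas : (N -> tvec R N) -> (N -> tvec R N) -> (N -> tvec R N)).
Variables (nb nbs : (M -> tvec R M) -> (M -> tvec R N) -> (M -> tvec R N)).
Variables (phi : N -> tvec R N -> tvec R N) (xi : N -> tvec R N).
Variable D : M -> set (tvec R M).
Hypothesis im : immersion iota.
Hypothesis rg : riemannian_metric g.
Hypothesis tphi : tensor11 phi.
Hypothesis cr : contact_CR iota g phi xi D.
Implicit Types (X Y : M -> tvec R M) (V : M -> tvec R N).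

Local Notation gam := (induced_metric iota g).

Let si : smooth_map iota := proj1 im.
Let rgam : riemannian_metric gam := induced_riemannian im rg.

Lemma cr_smooth : smooth_distribution D.
Proof. by case: cr. Qed.

Lemma cr_neq0 x : exists v, D x v.
Proof.
by case: cr => _ split_ _ _ _; have [d [_ [Dd _ _]]] := split_ x _ (tangent0 x); exists d.
Qed.

Let D_tangent x v : D x v -> tangent x v := distribution_tangent cr_smooth cr_neq0 (x := x) (v := v).

Lemma phi_tan_D X x : section D X ->
  D x (phi_tan iota g phi X x) /\
  tmap iota (phi_tan iota g phi X x) = phi (iota x) (push iota X x).
Proof.
move=> [_ DX]; have [_ _ _ phiD _] := cr; have [w Dw wE] := phiD x _ (DX x).
rewrite /phi_tan -[push iota X x]/(tmap iota (X x)) -wE.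
by rewrite (tan_part_tmap im rg (D_tangent Dw)).
Qed.

(** The scalar products of [phi X] with vector fields are smooth, which is
    enough for a pointwise section of [D]. *)
Lemma phi_tan_section X : section D X -> section D (phi_tan iota g phi X).
Proof.
move=> sX; have [vX _] := sX.
apply: (section_weak rgam cr_smooth cr_neq0) => [x|Y vY].
  by have [] := phi_tan_D x sX.
rewrite (_ : (fun x => _) = fun x => g (iota x) (phi (iota x) (push iota X x)) (push iota Y x)).
  apply: (metric_along si rg); last exact: push_along.
  by apply: (tensor11_along si tphi); exact: push_along.
apply/funext => x; rewrite /induced_metric.
by have [_ ->] := phi_tan_D x sX.
Qed.

Lemma push_phi_tan X : section D X ->
  push iota (phi_tan iota g phi X) = fun x => phi (iota x) (push iota X x).
Proof. by move=> sX; apply/funext => x; have [_ E] := phi_tan_D x sX; exact: E. Qed.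

Hypothesis ind : induced_connection iota nabla nb.
Hypothesis inds : induced_connection iota nablas nbs.
Hypothesis dual : dual_connection g nabla nablas.

Lemma shape_op_tangent X V x : vfield X -> vfield_along iota V ->
  tangent x (shape_op iota g nbs V X x).
Proof.
move=> vX aV; apply: tangentN; apply: (tan_part_tangent im rg).
exact: (induced_tangent inds).
Qed.

(** Differentiate [g (push iota Y) V = 0] along [X]. *)
Lemma shape_op_metric X Y V x : vfield X -> vfield Y -> normal_field iota g V ->
  g (iota x) (tmap iota (shape_op iota g nbs V X x)) (push iota Y x) =
  g (iota x) (nb X (push iota Y) x) (V x).
Proof.
move=> vX vY [aV nV]; have aY := push_along si vY.
have tY := vfield_tangent x vY; have tiY := along_tangent x aY.
have tV := along_tangent x aV.
have tn := induced_tangent inds x vX aV.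
have := induced_duality im rg x dual ind inds vX aY aV.
have -> : (fun y => g (iota y) (push iota Y y) (V y)) = fun=> 0.
  apply/funext => y; rewrite (metricC rg (along_tangent y aY) (along_tangent y aV)).
  by case: (nV y) => _; apply; exact: vfield_tangent.
rewrite (tangent_deriv_cst 0 (vfield_tangent x vX)) (metricC rg tiY tn).
rewrite /shape_op tmapN (metricNl rg) //; last first.
  by apply: (tmap_tangent im); exact: (tan_part_tangent im rg).
by rewrite (tan_part_metric im rg tn tY); move=> /eqP; rewrite eq_sym addr_eq0 => /eqP.
Qed.

Hypothesis mixed : mixed_totally_geodesic iota g D nb.

(** The component of [A_V X] orthogonal to [D] pairs to zero with itself, by
    mixed geodesy applied to [X] and to a section extending that component. *)
Lemma shape_op_D X V x : section D X -> normal_field iota g V ->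
  D x (shape_op iota g nbs V X x).
Proof.
move=> sX nV; have [vX _] := sX; have [aV nVx] := nV.
have [_ split_ _ _ _] := cr; have ta := shape_op_tangent x vX aV.
have [d [e [Dd [te pe] aE]]] := split_ x _ ta; rewrite aE.
suff -> : e = 0 by rewrite addr0.
have [Z [vZ pZ] Zx] := orthocompl_extend rgam cr_smooth cr_neq0 (conj te pe).
have aZ := push_along si vZ; have tn := induced_tangent ind x vX aZ.
have [tt _] := tan_partP im rg tn.
have e0 : nb X (push iota Z) x = tmap iota (tan_part iota g x (nb X (push iota Z) x)).
  have := congr1 (fun F => F x) (mixed sX (conj vZ pZ)); rewrite /second_form /nor_part /=.
  by move=> /eqP; rewrite subr_eq0 => /eqP.
have ge : gam x (shape_op iota g nbs V X x) e = 0.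
  rewrite -Zx; have := shape_op_metric x vX vZ nV.
  rewrite /induced_metric /push => ->; rewrite -/(push iota Z) e0.
  rewrite (metricC rg (tmap_tangent im tt) (along_tangent x aV)).
  by case: (nVx x) => _; apply.
have td := D_tangent Dd.
apply: (metric_eq0 rgam te); move: ge; rewrite aE (metricDl rgam) //.
by rewrite (metricC rgam td te) pe // add0r.
Qed.

Hypothesis vxi : vfield xi.
Hypothesis hphi : forall (A B : N -> tvec R N) p, vfield A -> vfield B ->
  nabla A (fun q => phi q (B q)) p - phi p (nablas A B p) =
  g p (B p) (xi p) *: A p - g p (B p) (A p) *: xi p.
Hypothesis skew : forall p u v, tangent p u -> tangent p v ->
  g p (phi p u) v = - g p u (phi p v).
Hypothesis tf : torsion_free nabla.
Hypothesis tfs : torsion_free nablas.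
Hypothesis foliate : involutive_distribution D.

(** The right-hand side of the structure identity is tangent to [M], because
    [xi] is, and so it is invisible to a normal [V]. *)
Lemma normal_phi X Y V x : section D X -> section D Y -> normal_field iota g V ->
  g (iota x) (nb X (fun y => phi (iota y) (push iota Y y)) x) (V x) =
  g (iota x) (phi (iota x) (nbs X (push iota Y) x)) (V x).
Proof.
move=> [vX DX] [vY DY] [aV nV]; have aY := push_along si vY.
have [_ _ [xiM [vxiM DxiM] xiE] _ _] := cr.
have tV := along_tangent x aV.
have aphi := tensor11_along si tphi aY.
have tphi1 p u : tangent p u -> tangent p (phi p u) by case: tphi => + _ _; apply.
have t1 := induced_tangent ind x vX aphi.
have t2 := tphi1 _ _ (induced_tangent inds x vX aY).
have tX := along_tangent x (push_along si vX).
have txi := along_tangent x (push_along si vxiM).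
apply/eqP; rewrite -subr_eq0 -(metricBl rg) //.
rewrite (induced_phi im rg x tphi vxi hphi ind inds vX aY).
have -> : xi (iota x) = push iota xiM x by rewrite xiE.
rewrite (metricBl rg) ?(metricZl rg) //; try exact: tangentZ.
have N0 W : vfield W -> g (iota x) (push iota W x) (V x) = 0.
  move=> vW; rewrite (metricC rg (along_tangent x (push_along si vW)) tV).
  by case: (nV x) => _; apply; exact: vfield_tangent.
by rewrite !N0 // !mulr0 subrr.
Qed.

(** Both terms lie in [D]; their sum is extended to a section [Y] of [D], and its
    scalar product with itself is computed along [Y]. *)
Lemma shape_op_anticommutes X V x : section D X -> normal_field iota g V ->
  tmap iota (shape_op iota g nbs V (phi_tan iota g phi X) x)
    + phi (iota x) (tmap iota (shape_op iota g nbs V X x)) = 0.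
Proof.
move=> sX nV; have [vX _] := sX; have [aV nVx] := nV.
have sW := phi_tan_section sX; have [vW _] := sW.
have D1 := shape_op_D x sW nV; have D2 := shape_op_D x sX nV.
have [_ _ _ phiD _] := cr; have [w Dw wE] := phiD x _ D2.
set a1 := shape_op _ _ _ _ _ _ in D1 *; set a2 := shape_op _ _ _ _ _ _ in D2 wE *.
have Dd : D x (a1 + w) by apply: (distributionD cr_smooth cr_neq0).
have td := D_tangent Dd; have tw := D_tangent Dw.
have t1 := D_tangent D1; have t2 := D_tangent D2.
rewrite -wE -tmapD; suff -> : a1 + w = 0 by exact: tmap0.
apply: (metric_eq0 rgam td).
have [Y sY Yx] := section_extend cr_smooth cr_neq0 Dd; have [vY _] := sY.
rewrite -[X in gam x _ X]Yx (metricDl rgam) //; last by rewrite Yx.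
have tV := along_tangent x aV.
have aX := push_along si vX; have aY := push_along si vY; have aW := push_along si vW.
have tiY := along_tangent x aY.
have tphi1 p u : tangent p u -> tangent p (phi p u) by case: tphi => + _ _; apply.
(* Symmetry of the second fundamental form moves phi X to the second slot. *)
have E1 : gam x a1 (Y x) = g (iota x) (phi (iota x) (nbs Y (push iota X) x)) (V x).
  apply: etrans (shape_op_metric x vW vY nV) _.
  have sB := foliate sW sY.
  have tor := induced_torsion_free im ind x tf vW vY (proj1 sB).
  have -> : nb (phi_tan iota g phi X) (push iota Y) x =
     tmap iota (bracket (phi_tan iota g phi X) Y x)
     + nb Y (push iota (phi_tan iota g phi X)) x by rewrite -tor subrK.
  have tB := vfield_tangent x (proj1 sB).
  rewrite (metricDl rg) //; [|exact: (tmap_tangent im)|exact: (induced_tangent ind)].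
  rewrite (metricC rg (tmap_tangent im tB) tV) (proj2 (nVx x)) // add0r.
  by rewrite push_phi_tan // normal_phi.
have E2 : gam x w (Y x) = - g (iota x) (phi (iota x) (nbs X (push iota Y) x)) (V x).
  rewrite /induced_metric wE skew //; last exact: (tmap_tangent im).
  congr (- _); have sP := phi_tan_section sY.
  have := shape_op_metric x vX (proj1 sP) nV; rewrite push_phi_tan // => ->.
  by rewrite normal_phi.
have sB := foliate sY sX; have tB := vfield_tangent x (proj1 sB).
have tn1 := induced_tangent inds x vY aX; have tn2 := induced_tangent inds x vX aY.
rewrite E1 E2 -(metricBl rg); try exact: tphi1; last exact: tV.
rewrite -(tensor11B tphi) // (induced_torsion_free im inds x tfs vY vX (proj1 sB)).
have [z Dz <-] := phiD x _ (proj2 sB x).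
have tz := D_tangent Dz.
by rewrite (metricC rg (tmap_tangent im tz) tV) (proj2 (nVx x)).
Qed.

End ContactCR.

Theorem theorem3p18 (R : realType) (m n : nat)
    (Mb : manifold R (2 * m).+1) (M : manifold R n)
    (nabla nablas : (Mb -> tvec R Mb) -> (Mb -> tvec R Mb) -> (Mb -> tvec R Mb))
    (g : Mb -> tvec R Mb -> tvec R Mb -> R)
    (phi : Mb -> tvec R Mb -> tvec R Mb)
    (xi : Mb -> tvec R Mb) (eta : Mb -> tvec R Mb -> R)
    (iota : M -> Mb) (D : M -> set (tvec R M))
    (nb nbs : (M -> tvec R M) -> (M -> tvec R Mb) -> (M -> tvec R Mb))
    (sasakian : sasakian_statistical nabla g phi xi eta)
    (dual : dual_connection g nabla nablas)
    (sub : immersion iota)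
    (ind : induced_connection iota nabla nb)
    (inds : induced_connection iota nablas nbs)
    (cr : contact_CR iota g phi xi D)
    (foliate : involutive_distribution D) :
  (mixed_totally_geodesic iota g D nb ->
   forall (X : M -> tvec R M) (V : M -> tvec R Mb),
     section D X -> normal_field iota g V ->
     forall x, tmap iota (shape_op iota g nbs V (phi_tan iota g phi X) x)
       + phi (iota x) (tmap iota (shape_op iota g nbs V X x)) = 0) /\
  (mixed_totally_geodesic iota g D nbs ->
   forall (X : M -> tvec R M) (V : M -> tvec R Mb),
     section D X -> normal_field iota g V ->
     forall x, tmap iota (shape_op iota g nb V (phi_tan iota g phi X) x)
       + phi (iota x) (tmap iota (shape_op iota g nb V X x)) = 0).
Proof.
have rg := sasakian_metric sasakian; have tphi := sasakian_tensor sasakian.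
have tfs := dual_torsion_free sasakian dual.
have [[_ an tf _] [[_ vxi _] _ _ _ _] _] := sasakian.
have skew := sasakian_skew sasakian.
have dual' := dual_connection_sym rg an dual.
split=> mixed X V sX nV x.
- apply: (shape_op_anticommutes sub rg tphi cr ind inds dual mixed vxi _ skew tf tfs foliate) => //.
  by move=> A B p vA vB; have [] := sasakian_phi sasakian dual p vA vB.
- apply: (shape_op_anticommutes sub rg tphi cr inds ind dual' mixed vxi _ skew tfs tf foliate) => //.
  by move=> A B p vA vB; have [] := sasakian_phi sasakian dual p vA vB.
Qed.
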